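(* Let $T$ be a positive theory. The following are equivalent for a formula $\phi(x,y)$: (i) $\phi$ is stable; (ii) $|\operatorname{S}_\phi(B)|\le(|B|+|T|)^{|T|}$ for every parameter set $B$; (iii) $\phi$ does not have the order property; (iv) $\phi$ does not have the binary tree property; (v) $R_{\phi,\psi}(x=x)<\omega$ for every negation $\psi(x,y)$ of $\phi(x,y)$; (vi) for every parameter set $B$, every type $p(x)$ over $B$ is $\phi$-definable.
   Context: Positive logic conventions. Fix a first-order signature $\mathcal L$. A formula always means a positive formula: one built from atomic formulas using $\wedge,\vee,\top,\bot,\exists$. A (positive) theory $T$ is a set of h-inductive sentences, i.e. sentences $\forall x(\phi(x)\to\psi(x))$ with $\phi,\psi$ positive formulas. $|T|$ denotes the (infinite) number of $\mathcal L$-formulas. Variables $x,y,\dots$ in formulas are finite tuples. A negation of a formula $\phi(x)$ is a (positive) formula $\psi(x)$ with $T\models\neg\exists x(\phi(x)\wedge\psi(x))$. A model $M$ of $T$ is existentially closed (e.c.) if whenever $M\not\models\phi(a)$ there is a negation $\psi$ of $\phi$ with $M\models\psi(a)$. Standing assumption: $T$ has the joint continuation property (any two models of $T$ admit homomorphisms into a common model of $T$), and one works in a monster model $\mathfrak M$: an e.c. model that is very homogeneous (small tuples have the same positive type over a small set iff conjugate by an automorphism fixing that set) and very saturated (small finitely satisfiable sets of positive formulas over $\mathfrak M$ are satisfiable in $\mathfrak M$). All parameters are in $\mathfrak M$ and parameter sets are small; $\models\phi(a)$ means $\mathfrak M\models\phi(a)$; consistent means satisfiable in $\mathfrak M$.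 A type over $B$ is a set $\operatorname{tp}(a/B)$ of all positive formulas over $B$ satisfied by some tuple $a$. $\phi$-types: $\operatorname{tp}_\phi(a/B)=\{\phi(x,b):\ \models\phi(a,b),\ b\in B\}$ ($b$ ranging over tuples from $B$), and $\operatorname{S}_\phi(B)$ is the set of all $\operatorname{tp}_\phi(a/B)$. For infinite $\lambda$, $\phi$ is $\lambda$-stable if $|B|\le\lambda$ implies $|\operatorname{S}_\phi(B)|\le\lambda$; $\phi$ is stable if it is $\lambda$-stable for some infinite $\lambda$. $\phi$-definability: a $\phi$-definition over $C$ of a type $p(x)$ over $B$ is a partial type (set of positive formulas) $\operatorname{d}_p\phi(y)$ over $C$ with $|\operatorname{d}_p\phi(y)|\le|T|$ such that, for tuples $b$ from $B$, $\phi(x,b)\in p(x)$ iff $\models\operatorname{d}_p\phi(b)$. $p$ is $\phi$-definable if it has a $\phi$-definition over $B$. Order property: $\phi(x,y)$ has it if there are $(a_i)_{i<\omega}$, $(b_i)_{i<\omega}$ and a negation $\psi(x,y)$ of $\phi(x,y)$ such that for all $i,j<\omega$: $\models\phi(a_i,b_j)$ if $i<j$ and $\models\psi(a_i,b_j)$ if $i\ge j$. Binary tree property: $\phi(x,y)$ has it if there are a negation $\psi(x,y)$ of $\phi(x,y)$ and $(b_\eta)_{\eta\in2^{<\omega}}$ such that for every $\sigma\in2^\omega$ the set $\{\chi_{\sigma(n)}(x,b_{\sigma|_n}):n<\omega\}$ is consistent, where $\chi_0:=\phi$, $\chi_1:=\psi$. Rank: for contradictory formulas $\phi(x,y),\psi(x,y)$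 (i.e. $\psi$ a negation of $\phi$), $R_{\phi,\psi}$ is the least function from sets of formulas $\Sigma(x)$ (possibly with parameters) in free variables $x$ to the ordinals together with $-1$ and $\infty$ such that: $R_{\phi,\psi}(\Sigma)\ge0$ if $\Sigma$ is consistent; $R_{\phi,\psi}(\Sigma)\ge\alpha+1$ if there is $b$ with $R_{\phi,\psi}(\Sigma\cup\{\phi(x,b)\})\ge\alpha$ and $R_{\phi,\psi}(\Sigma\cup\{\psi(x,b)\})\ge\alpha$; and for limit $\ell$, $R_{\phi,\psi}(\Sigma)\ge\ell$ if $R_{\phi,\psi}(\Sigma)\ge\alpha$ for all $\alpha<\ell$. *)

(* Defs.v *)
From mathcomp Require Import all_boot.
From mathcomp Require Import boolp classical_sets functions cardinality.

Set Implicit Arguments.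
Unset Strict Implicit.
Unset Printing Implicit Defensive.

Local Open Scope classical_set_scope.
Local Open Scope card_scope.

(** ** Syntax *)

Record signature := Signature {
  fsym : Type;
  farity : fsym -> nat;
  rsym : Type;
  rarity : rsym -> nat }.

Section Syntax.
Variable L : signature.

Inductive term (V : Type) : Type :=
| Var of V
| App (f : fsym L) of ('I_(farity f) -> term V).

(* Positive formulas with free variables in [V]; [Ex] binds [None].  The type
   [V] serves for parameters as well: a formula in variables [X] with
   parameters from [P] is an element of [form (X + P)]. *)
Inductive form (V : Type) : Type :=
| Top
| Bot
| Eq of term V & term V
| Rel (r : rsym L) of ('I_(rarity r) -> term V)
| And of form V & form V
| Or of form V & form V
| Ex of form (option V).

Fixpoint trename (V W : Type) (h : V -> W) (t : term V) : term W :=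
  match t with
  | Var x => Var (h x)
  | App f ts => App (fun i => trename h (ts i))
  end.

Fixpoint rename (V W : Type) (h : V -> W) (phi : form V) : form W :=
  match phi with
  | Top => Top W
  | Bot => Bot W
  | Eq s t => Eq (trename h s) (trename h t)
  | Rel r ts => Rel (fun i => trename h (ts i))
  | And p q => And (rename h p) (rename h q)
  | Or p q => Or (rename h p) (rename h q)
  | Ex p => Ex (rename (omap h) p)
  end.

Definition join (X Y C : Type) (a : X -> C) (b : Y -> C) (z : X + Y) : C :=
  match z with inl x => a x | inr y => b y end.

(* phi(x,b), the parameters b being substituted for the variables y *)
Definition inst (X Y P : Type) (phi : form (X + Y)) (b : Y -> P) : form (X + P) :=
  rename (join inl (inr \o b)) phi.

(* the formula x = x, for the tuple of variables x = (x_i)_{i < m} *)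
Definition var_eqxx (m : nat) (P : Type) : form ('I_m + P) :=
  \big[@And _/@Top _]_(i < m) Eq (Var (inl i)) (Var (inl i)).

(* forall v_0 ... v_(k-1), (premise -> conclusion) *)
Record hsentence := HSentence {
  hvars : nat;
  premise : form 'I_hvars;
  conclusion : form 'I_hvars }.

Definition theory := set hsentence.

(** ** Semantics *)

Record structure := Structure {
  carrier :> Type;
  finterp : forall f : fsym L, ('I_(farity f) -> carrier) -> carrier;
  rinterp : forall r : rsym L, ('I_(rarity r) -> carrier) -> Prop;
  carrier_inhabited : inhabited carrier }.

End Syntax.

Arguments Top {L V}.
Arguments Bot {L V}.
Arguments var_eqxx {L} m {P}.

Section Semantics.
Variable L : signature.
Implicit Types (M N : structure L) (T : theory L).

Fixpoint eval M (V : Type) (v : V -> M) (t : term L V) : M :=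
  match t with
  | Var x => v x
  | App f ts => finterp (fun i => eval v (ts i))
  end.

Fixpoint sat M (V : Type) (phi : form L V) : (V -> M) -> Prop :=
  match phi with
  | Top => fun _ => True
  | Bot => fun _ => False
  | Eq s t => fun v => eval v s = eval v t
  | Rel r ts => fun v => rinterp (fun i => eval v (ts i))
  | And p q => fun v => sat p v /\ sat q v
  | Or p q => fun v => sat p v \/ sat q v
  | Ex p => fun v => exists c : M, sat p (oapp v c)
  end.

Definition model T M : Prop :=
  forall s, T s -> forall v : 'I_(hvars s) -> M,
    sat (premise s) v -> sat (conclusion s) v.

Definition hom M N (h : M -> N) : Prop :=
  (forall (f : fsym L) (a : 'I_(farity f) -> M),
      h (finterp a) = finterp (h \o a)) /\
  (forall (r : rsym L) (a : 'I_(rarity r) -> M),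
      rinterp a -> rinterp (h \o a)).

Definition automorphism M (s : M -> M) : Prop :=
  exists2 s' : M -> M, hom s /\ hom s' & cancel s s' /\ cancel s' s.

Definition joint_continuation T : Prop :=
  forall M N, model T M -> model T N ->
    exists P : structure L, [/\ model T P,
      exists h : M -> P, hom h & exists k : N -> P, hom k].

(* psi is a negation of phi: T |= ~ exists v, phi(v) /\ psi(v) *)
Definition negation T (V : Type) (phi psi : form L V) : Prop :=
  forall N, model T N -> ~ exists v : V -> N, sat phi v /\ sat psi v.

Definition ec T M : Prop :=
  model T M /\
  forall (n : nat) (phi : form L 'I_n) (a : 'I_n -> M), ~ sat phi a ->
    exists2 psi : form L 'I_n, negation T phi psi & sat psi a.

(** ** Monster models *)

(* A cardinal kappa is represented by a type [K] of that cardinality;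
   small means of cardinality < kappa. *)
Definition small (K X : Type) (A : set X) : Prop :=
  (A #<= [set: K]) /\ ~ ([set: K] #<= A).

Definition strong_limit (K : Type) : Prop :=
  forall X : Type, small K [set: X] -> small K [set: set X].

(* satisfiability in M of a set of formulas with parameters in M, in an
   arbitrary family X of variables *)
Definition consistent M (X : Type) (S : set (form L (X + M))) : Prop :=
  exists a : X -> M, forall chi, S chi -> sat chi (join a id).

(* [form L nat] is the set of formulas in countably many variables, so |T| is
   its cardinality. *)
Record monster T (K : Type) M : Prop := Monster {
  monster_strong_limit : strong_limit K;
  monster_language : small K [set: form L nat];
  monster_ec : ec T M;
  monster_homogeneous :
    forall (I : Type) (a a' : I -> M) (A : set M),
      small K [set: I] -> small K A ->
      (forall chi : form L (I + A),
         sat chi (join a val) <-> sat chi (join a' val)) <->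
      (exists s : M -> M, [/\ automorphism s,
         forall c, A c -> s c = c & forall i, s (a i) = a' i]);
  monster_saturated :
    forall (X : Type) (S : set (form L (X + M))),
      small K [set: X] -> small K S ->
      (forall D, D `<=` S -> finite_set D -> consistent D) -> consistent S }.

(** ** Types and stability *)

Section Formula.
Variables (T : theory L) (M : structure L) (m n : nat).
Implicit Types (phi psi : form L ('I_m + 'I_n)) (B C : set M).

Definition tp (a : 'I_m -> M) B : set (form L ('I_m + B)) :=
  [set chi | sat chi (join a val)].
Arguments tp a B : clear implicits.

Definition is_type B (p : set (form L ('I_m + B))) : Prop :=
  exists a, p = tp a B.

Definition tp_phi phi (a : 'I_m -> M) B : set (form L ('I_m + B)) :=
  [set inst phi b | b in [set b : 'I_n -> B | sat phi (join a (val \o b))]].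
Arguments tp_phi phi a B : clear implicits.

Definition S_phi phi B : set (set (form L ('I_m + B))) :=
  range (fun a => tp_phi phi a B).
Arguments S_phi phi B : clear implicits.

(* the cardinal lambda is the cardinality of the type Lam *)
Definition lambda_stable phi (Lam : Type) : Prop :=
  forall B, B #<= [set: Lam] -> S_phi phi B #<= [set: Lam].

(* As all parameter sets are small, so are the cardinals lambda: every phi is
   trivially lambda-stable for lambda >= 2^|M|. *)
Definition stable (K : Type) phi : Prop :=
  exists Lam : Type, [/\ infinite_set [set: Lam], small K [set: Lam] &
    lambda_stable phi Lam].

Definition phi_definition phi B (p : set (form L ('I_m + B))) C
    (d : set (form L ('I_n + C))) : Prop :=
  d #<= [set: form L nat] /\
  forall b : 'I_n -> B,
    p (inst phi b) <-> (forall chi, d chi -> sat chi (join (val \o b) val)).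

Definition phi_definable phi B (p : set (form L ('I_m + B))) : Prop :=
  exists d : set (form L ('I_n + B)), phi_definition phi p d.

Definition order_property phi : Prop :=
  exists (a : nat -> 'I_m -> M) (b : nat -> 'I_n -> M) psi,
    negation T phi psi /\
    forall i j : nat, (i < j -> sat phi (join (a i) (b j))) /\
                      (j <= i -> sat psi (join (a i) (b j))).

(* Elements of 2^{<omega} are finite sequences of booleans (false being 0),
   and sigma|_n is [mkseq sigma n]. *)
Definition binary_tree_property phi : Prop :=
  exists psi (b : seq bool -> 'I_n -> M),
    negation T phi psi /\
    forall sigma : nat -> bool,
      consistent [set inst (if sigma k then psi else phi) (b (mkseq sigma k))
                 | k in [set: nat]].

End Formula.
End Semantics.

Arguments tp {L M m} a B.
Arguments tp_phi {L M m n} phi a B.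
Arguments S_phi {L M m n} phi B.
Arguments lambda_stable {L} M {m n} phi Lam.
Arguments stable {L} M {m n} K phi.
Arguments order_property {L} T M {m n} phi.
Arguments binary_tree_property {L} T M {m n} phi.

(** ** Ordinals *)

(* [Sup f] is the least ordinal strictly above all [f i]; ordinals are the
   classes of this total preorder. *)
Inductive ord : Type := Sup (X : Type) (f : X -> ord).

Fixpoint ord_le (a b : ord) : Prop :=
  match a, b with
  | Sup X f, Sup Y g => forall i, exists j, ord_le (f i) (g j)
  end.

Definition ord_lt (a b : ord) : Prop :=
  match b with Sup X g => exists j, ord_le a (g j) end.

Definition ord_zero : ord := Sup (fun x : void => match x with end).
Definition ord_succ (a : ord) : ord := Sup (fun _ : unit => a).
Definition ord_omega : ord := Sup (fun n : nat => iter n ord_succ ord_zero).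

Definition ord_limit (l : ord) : Prop :=
  ord_lt ord_zero l /\ forall a, ord_lt a l -> ord_lt (ord_succ a) l.

(* ordinals together with -1 and infinity *)
Inductive xord : Type := XNeg1 | XOrd of ord | XInf.

Definition xord_le (u v : xord) : Prop :=
  match u, v with
  | XNeg1, _ => True
  | _, XInf => True
  | XOrd a, XOrd b => ord_le a b
  | _, _ => False
  end.

Definition xord_lt (u v : xord) : Prop := xord_le u v /\ ~ xord_le v u.

Lemma ord_le_trans a b c : ord_le a b -> ord_le b c -> ord_le a c.
Proof.
elim: a b c => I f IH [J g] [H h] /= fg gh i.
have [j fij] := fg i; have [k gjk] := gh j.
by exists k; apply: IH fij gjk.
Qed.

Lemma ord_nle_lt a b : ~ ord_le a b -> ord_lt b a.
Proof.
elim: a b => I f IH [J g] /= /existsNP[i /forallNP nfg].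
exists i; case: (f i) (IH i) nfg => H h IHi nfg j.
exact: IHi (nfg j).
Qed.

Lemma ord_lt_le a b c : ord_lt a b -> ord_le b c -> ord_lt a c.
Proof.
case: b c => [J g] [H h] /= [j aj] gh; have [k gjk] := gh j.
by exists k; apply: ord_le_trans aj gjk.
Qed.

Lemma ord_least (P : ord -> Prop) a :
  P a -> exists2 b, P b & forall c, P c -> ord_le b c.
Proof.
move=> Pa; have aa : ord_le a a by elim: a {Pa} => I f IH /= i; exists i.
suff: forall b, P b -> ord_le b a -> exists2 b, P b & forall c, P c -> ord_le b c.
  by move/(_ a Pa aa).
elim: a {Pa aa} => I f IH b Pb ba.
have [|/existsNP[c /not_implyP[Pc /ord_nle_lt cb]]] :=
  pselect (forall c, P c -> ord_le b c); first by exists b.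
by have [i cfi] := ord_lt_le cb ba; apply: IH Pc cfi.
Qed.

Lemma xord_le_trans u v w : xord_le u v -> xord_le v w -> xord_le u w.
Proof. by case: u v w => [|a|] [|b|] [|c|] //=; apply: ord_le_trans. Qed.

Lemma xord_least (P : xord -> Prop) u :
  P u -> exists2 v, P v & forall w, P w -> xord_le v w.
Proof.
move=> Pu; have [P1|nP1] := pselect (P XNeg1); first by exists XNeg1.
have [[a Pa]|nPo] := pselect (exists a, P (XOrd a)).
  have [b Pb bmin] := @ord_least (P \o XOrd) a Pa.
  by exists (XOrd b) => // -[|c|] //; apply: bmin.
exists u => // -[|c|] //; last by case: u {Pu}.
by move=> Pc; case: nPo; exists c.
Qed.

(** ** Rank *)

Section Rank.
Variables (L : signature) (M : structure L) (m n : nat).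
Variables (phi psi : form L ('I_m + 'I_n)).

Definition rank_closed (R : set (form L ('I_m + M)) -> xord) : Prop :=
  [/\ forall S, consistent S -> xord_le (XOrd ord_zero) (R S),
      forall S a, (exists b : 'I_n -> M,
          xord_le (XOrd a) (R (S `|` [set inst phi b])) /\
          xord_le (XOrd a) (R (S `|` [set inst psi b]))) ->
        xord_le (XOrd (ord_succ a)) (R S) &
      forall S l, ord_limit l ->
        (forall a, ord_lt a l -> xord_le (XOrd a) (R S)) ->
        xord_le (XOrd l) (R S)].

Lemma rank_exists : exists R, rank_closed R /\
  forall R', rank_closed R' -> forall S, xord_le (R S) (R' S).
Proof.
have cI : rank_closed (fun _ => XInf) by split.
have least S : exists v, (exists2 R, rank_closed R & v = R S) /\
    forall R', rank_closed R' -> xord_le v (R' S).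
  have [|v Pv vmin] := @xord_least
    (fun v => exists2 R, rank_closed R & v = R S) XInf; first by exists (fun=> XInf).
  by exists v; split=> // R' cR'; apply: vmin; exists R'.
have [R0 R0P] := choice least.
exists R0; split=> [|R' cR' S]; last exact: (R0P S).2.
split=> S.
- by move=> Scons; have [[R [cR _ _] ->] _] := R0P S; apply: cR.
- move=> a [b [aphi apsi]]; have [[R cR ->] _] := R0P S.
  case: (cR) => _ cR2 _; apply: cR2; exists b.
  by split; [move: aphi|move: apsi] => /xord_le_trans; apply; apply: (R0P _).2.
- by move=> l ll; have [[R [_ _ cR] ->] _] := R0P S; apply: cR.
Qed.

(* R_{phi,psi}, the least such function *)
Definition rank : set (form L ('I_m + M)) -> xord := projT1 (cid rank_exists).

Lemma rankP : rank_closed rank /\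
  forall R, rank_closed R -> forall S, xord_le (rank S) (R S).
Proof. exact: projT2 (cid rank_exists). Qed.

End Rank.

(* Main.v *)
From Stdlib Require List.
Require Import Defs.
From mathcomp Require Import all_boot zify.
From mathcomp Require Import boolp classical_sets functions cardinality wochoice.

Set Implicit Arguments.
Unset Strict Implicit.
Unset Printing Implicit Defensive.

Local Open Scope classical_set_scope.
Local Open Scope card_scope.

(** Each of the six conditions says that, for every negation [psi] of [phi], the
   trees built from [phi] and [psi] have bounded height. Such a tree branches at
   a node [b] according to [phi(x, b)] and [psi(x, b)], and every branch is
   realized by a leaf ([has_tree]). The existence of a tree of height [k] with
   leaves in a definable set is expressed by a positive formula
   ([sat_tree_form]), so that saturation applies to heights.

   The rank of [x = x] is finite exactly when the heights are bounded
   ([rank_lt_omega]), because the height satisfies the clauses that define the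
   rank. If the heights are unbounded, saturation yields trees the levels of
   which form any small linear order ([tall_tree]). Levels in [nat] give the
   binary tree property. Levels in the least well-order with more than [lambda]
   branches give [lambda] nodes only, as [lambda * lambda = lambda], and more
   than [lambda] types over them: [phi] is not [lambda]-stable
   ([stable_no_tree]).

   If the heights are bounded, choose for each negation [psi] a formula [theta]
   of a type [p] for which they are least, say less than [k + 1]. Then
   [phi(x, b)] belongs to [p] exactly when, for every [psi], the formula
   [theta(x)] and [phi(x, b)] together still have a tree of height [k]: if
   [phi(x, b)] fails then, by existential closedness, it is because [psi(x, b)]
   holds for some [psi], and two such trees would make up a tree of height
   [k + 1]. This defines [p] by [|T|] formulas ([definable_of_no_tree]).
   Counting definitions bounds the number of types ([count_of_definable]), and
   for [lambda = 2 ^ |T|] the bound is [lambda] ([stable_of_count]).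

   An order contains trees of all heights, by bisection ([trees_of_order]).
   The converse ([tree_order_property]) is the main difficulty. In first-order
   logic (Hodges) a ladder is grown inside a tall tree: given a leaf [c] one
   passes to a tall subtree the nodes of which all satisfy [phi(c, y)], or all
   fail to. Here failing to satisfy [phi] is no formula but an infinite
   disjunction of negations, and the order property wants the same negation
   throughout. Tall subtrees are therefore replaced by good sets of constraints
   ([good]), which have trees of all finite heights. All nodes can be made to
   relate to [c] by [phi], or by one and the same negation ([good_colour]), and
   the ladder can be prolonged until it has more than [|T|] entries, infinitely
   many of which then share their negation ([uniform_ladder]). *)

(** * Cardinalities *)

Definition embeds (X Y : Type) : Prop := exists f : X -> Y, injective f.
Local Notation "X ≼ Y" := (embeds X Y) (at level 70, no associativity).

Lemma embeds_refl X : X ≼ X. Proof. by exists id. Qed.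

Lemma embeds_trans Y X Z : X ≼ Y -> Y ≼ Z -> X ≼ Z.
Proof. by move=> [f fI] [g gI]; exists (g \o f); apply: inj_comp. Qed.

Lemma embeds_prod X Y X' Y' : X ≼ X' -> Y ≼ Y' -> X * Y ≼ X' * Y'.
Proof.
move=> [f fI] [g gI]; exists (fun z => (f z.1, g z.2)).
by move=> [a b] [c d] /= [/fI -> /gI ->].
Qed.

Lemma embeds_sum X Y X' Y' : X ≼ X' -> Y ≼ Y' -> X + Y ≼ X' + Y'.
Proof.
move=> [f fI] [g gI].
exists (fun z => match z with inl a => inl (f a) | inr b => inr (g b) end).
by move=> [a|b] [c|d] //= [] => [/fI|/gI] ->.
Qed.

Lemma embeds_funr X Y Z : Y ≼ Z -> (X -> Y) ≼ (X -> Z).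
Proof.
move=> [f fI]; exists (fun g => f \o g) => g h gh.
by apply: funext => x; apply: fI; apply: (congr1 (@^~ x) gh).
Qed.

Lemma surj_embeds X Y (f : Y -> X) : (forall x, exists y, f y = x) -> X ≼ Y.
Proof. by move=> /choice[g gK]; exists g; apply: can_inj gK. Qed.

Lemma card_leE X Y (A : set X) (B : set Y) : (A #<= B) <-> (A ≼ B).
Proof.
split=> [/card_leP[f]|[f fI]].
  by exists f => x y fxy; apply: (@inj _ _ _ f); rewrite ?inE.
by apply/card_leP/injfunPex; exists f => // x y _ _; apply: fI.
Qed.

Lemma embeds_setT X : X ≼ [set: X].
Proof. by exists (fun x => SigSub (mem_setT x)) => x y /(congr1 val). Qed.

Lemma embeds_set X (A : set X) : A ≼ X.
Proof. by exists val; apply: val_inj. Qed.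

Lemma card_leTE X Y : ([set: X] #<= [set: Y]) <-> (X ≼ Y).
Proof.
rewrite card_leE; split=> XY.
  exact: embeds_trans (embeds_setT X) (embeds_trans XY (embeds_set _)).
exact: embeds_trans (embeds_set _) (embeds_trans XY (embeds_setT Y)).
Qed.

Lemma card_leTr X Y (A : set X) : (A #<= [set: Y]) <-> (A ≼ Y).
Proof.
rewrite card_leE; split=> XY; first exact: embeds_trans XY (embeds_set _).
exact: embeds_trans XY (embeds_setT Y).
Qed.

Lemma embeds_setU X (A B : set X) : (A `|` B : set X) ≼ A + B.
Proof.
apply: (@surj_embeds _ _ (fun z : A + B => match z with
  | inl a => SigSub (mem_set (@subsetUl _ A B _ (set_valP a)))
  | inr b => SigSub (mem_set (@subsetUr _ A B _ (set_valP b)))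
  end)) => -[x xAB].
have [Ax|Bx] := set_mem xAB.
  by exists (inl (SigSub (mem_set Ax))); apply: val_inj.
by exists (inr (SigSub (mem_set Bx))); apply: val_inj.
Qed.

Lemma embeds_image X Y (f : X -> Y) (A : set X) : (f @` A : set Y) ≼ A.
Proof. by apply/card_leE; apply: card_image_le. Qed.

Lemma chain_pair X (F : set (set X)) A B x y : total_on F subset ->
  F A -> F B -> A x -> B y -> exists C, [/\ F C, C x & C y].
Proof.
move=> Ftot FA FB Ax By.
by have [/(_ _ Ax)|/(_ _ By)] := Ftot _ _ FA FB; [exists B|exists A].
Qed.

Lemma embeds_total X Y : X ≼ Y \/ Y ≼ X.
Proof.
pose P (G : set (X * Y)) := forall p q, G p -> G q -> p.1 = q.1 <-> p.2 = q.2.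
have [F FP Ftot p q [A FA Ap] [B FB Bq]|G [GP Gmax]] := @Zorn_bigcup _ P.
  by have [C [/FP CP Cp Cq]] := chain_pair Ftot FA FB Ap Bq; apply: CP.
have [|/existsNP[x nx]] := pselect (forall x, exists y, G (x, y)).
  by move=> /choice[f fG]; left; exists f => x y /(GP _ _ (fG x) (fG y)).
right; have [|/existsNP[y ny]] := pselect (forall y, exists x, G (x, y)).
  by move=> /choice[f fG]; exists f => a b /(GP _ _ (fG a) (fG b)).
exfalso; apply: (Gmax (G `|` [set (x, y)])).
  split; last by move=> /(_ (x, y) (or_intror erefl)) Gxy; apply: nx; exists y.
  exact: subsetUl.
move=> [a b] [c d] /= [Gp|[-> ->]] [Gq|[-> ->]] //=.
- exact: (GP (a, b) (c, d)).
- by split=> e; subst; [case: nx; exists b|case: ny; exists a].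
- by split=> e; subst; [case: nx; exists d|case: ny; exists c].
Qed.

(** Hessenberg's theorem, by Zorn's lemma on the bijections between the square
   of a subset [D] and a part of [D]: a maximal one has a domain [D] which
   absorbs its complement, because otherwise the complement would contain a
   copy [D'] of [D], with enough room to extend the bijection to the square of
   the union of [D] and [D']. *)
Lemma embeds_square X : nat ≼ X -> X * X ≼ X.
Proof.
move=> [i iI].
pose D (G : set (X * X * X)) : set X := [set x | exists z, G (x, x, z)].
pose ok (G : set (X * X * X)) :=
  [/\ forall p q, G p -> G q -> p.1 = q.1 <-> p.2 = q.2,
      forall x y z, G (x, y, z) -> [/\ D G x, D G y & D G z] &
      forall x y, D G x -> D G y -> exists z, G (x, y, z)].
(* A finite [D] may have no extension, so the bijections extend [G0], that of a
   copy of [nat]. *)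
pose G0 : set (X * X * X) := [set (i n.1, i n.2, i (pickle n)) | n in setT].
have okG0 : ok G0.
  have DG0 n : D G0 (i n) by exists (i (pickle (n, n))), (n, n).
  split.
  - move=> _ _ [n _ <-] [k _ <-] /=; split=> [[/iI e1 /iI e2]|/iI].
      by rewrite [n]surjective_pairing [k]surjective_pairing e1 e2.
    by move=> /(pcan_inj pickleK) ->.
  - by move=> x y z [n _ [<- <- <-]]; split.
  - move=> _ _ [z [n _ [<- _ _]]] [z' [k _ [<- _ _]]].
    by exists (i (pickle (n.1, k.1))), (n.1, k.1).
have [F FP Ftot|G [okG Gmax]] := @Zorn_bigcup _ (fun G => ok (G0 `|` G)).
  pose F' := [set G0 `|` A | A in F] `|` [set G0].
  have F'ok A : F' A -> ok A by case=> [[B /FP okB <-]|->].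
  have F'tot : total_on F' subset.
    move=> _ _ [[A FA <-]|->] [[B FB <-]|->]; try by [left; apply: subsetUl
      |right; apply: subsetUl|left].
    by have [AB|BA] := Ftot _ _ FA FB; [left|right]; apply: setUS.
  have -> : G0 `|` \bigcup_(A in F) A = \bigcup_(A in F') A.
    apply/seteqP; split=> [x [G0x|[A FA Ax]]|x [_ [[A FA <-]|->]] /=].
    - by exists G0 => //; right.
    - by exists (G0 `|` A); [left; exists A|right].
    - by case=> [|Ax]; [left|right; exists A].
    - by left.
  have Dsub A : F' A -> D A `<=` D (\bigcup_(A in F') A).
    by move=> F'A x [z Az]; exists z, A.
  split.
  - move=> p q [A FA Ap] [B FB Bq].
    by have [C [/F'ok[CP _ _] Cp Cq]] := chain_pair F'tot FA FB Ap Bq; apply: CP.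
  - move=> x y z [A FA Ap]; have [_ AP _] := F'ok _ FA.
    by have [] := AP _ _ _ Ap; split; apply: Dsub FA _ _.
  - move=> x y [z [A FA Az]] [z' [B FB Bz]].
    have [C [FC Cx Cy]] := chain_pair F'tot FA FB Az Bz.
    have [_ _ CP] := F'ok _ FC.
    have [||t Ct] := CP x y; [by exists z|by exists z'|].
    by exists t, C.
set H := G0 `|` G in okG; have [H1 H2 H3] := okG; pose DH := D H.
have natDH : nat ≼ DH.
  have DHi n : DH (i n) by exists (i (pickle (n, n))); left; exists (n, n).
  by exists (fun n => SigSub (mem_set (DHi n))) => a b /(congr1 val)/iI.
have sqDH : DH * DH ≼ DH.
  have /choice[f fP] (u : DH * DH) : exists z : DH, H (val u.1, val u.2, val z).
    have [z Hz] := H3 _ _ (set_valP u.1) (set_valP u.2).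
    by have [_ _ Dz] := H2 _ _ _ Hz; exists (SigSub (mem_set Dz)).
  exists f => u v fuv.
  have := H1 _ _ (fP u) (fP v); rewrite fuv => /= -[_ /(_ erefl)[]].
  by move=> /val_inj e1 /val_inj e2; rewrite (surjective_pairing u) e1 e2; case: (v).
have dblDH : DH + DH ≼ DH.
  apply: embeds_trans sqDH; have [f fI] := natDH.
  exists (fun z => match z with inl a => (f 0, a) | inr b => (f 1, b) end).
  by move=> [a|b] [c|d] // [] => [->|/fI|/fI|->].
have XDH : X ≼ DH.
  have XD : X ≼ DH + ~` DH.
    apply: embeds_trans (embeds_setT X) _.
    by rewrite -(setUv DH); apply: embeds_setU.
  have [DHC|DHC] := embeds_total (~` DH : set X) DH.
    apply: embeds_trans dblDH; apply: embeds_trans XD _.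
    by apply: embeds_sum => //; apply: embeds_refl.
  exfalso; have [h hI] := DHC.
  pose D' : set X := [set val (h x) | x in setT].
  pose D1 := DH `|` D'.
  have D'E x : D' x -> ~ DH x by move=> [y _ <-]; apply: (set_valP (h y)).
  have D'DH : D' ≼ DH.
    by apply: embeds_trans (embeds_image _ _) (embeds_set _).
  have D1DH : D1 ≼ DH.
    apply: embeds_trans dblDH; apply: embeds_trans (embeds_setU _ _) _.
    by apply: embeds_sum => //; apply: embeds_refl.
  have DHD' : DH ≼ D'.
    have hD x : D' (val (h x)) by exists x.
    exists (fun x => SigSub (mem_set (hD x))).
    by move=> x y /(congr1 val) /= /val_inj /hI.
  have [k kI] : D1 * D1 ≼ D'.
    apply: embeds_trans DHD'; apply: embeds_trans sqDH.
    exact: embeds_prod.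
  pose N : set (X * X * X) := [set (val u.1, val u.2, val (k u)) |
    u in [set u | ~ (DH (val u.1) /\ DH (val u.2))]].
  have DHN : D (H `|` N) = D1.
    apply/seteqP; split=> [x [z [Hx|[u _ [<- _ _]]]]|x].
    - by left; exists z.
    - exact: set_valP.
    move=> D1x; have [Dx|nDx] := pselect (DH x).
      by have [z Hz] := H3 _ _ Dx Dx; exists z; left.
    pose u := SigSub (mem_set D1x) : D1.
    by exists (val (k (u, u))); right; exists (u, u) => //= -[].
  have okHN : ok (H `|` N).
    split; rewrite ?DHN.
    - move=> p q [Hp|[u nu <-]] [Hq|[v nv <-]] /=; first exact: H1.
      + case: p Hp => -[x y] z Hp /=; have [Dx Dy Dz] := H2 _ _ _ Hp.
        split=> [[ex ey]|e]; first by case: nv; rewrite /= -ex -ey.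
        by case: (D'E (val (k v))); [exact: set_valP|rewrite /= -e].
      + case: q Hq => -[x y] z Hq /=; have [Dx Dy Dz] := H2 _ _ _ Hq.
        split=> [[ex ey]|e]; first by case: nu; rewrite /= ex ey.
        by case: (D'E (val (k u))); [exact: set_valP|rewrite /= e].
      + split=> [[/val_inj e1 /val_inj e2]|/val_inj/kI -> //].
        by rewrite (surjective_pairing u) e1 e2; case: (v).
    - move=> x y z [Hx|[u _ [<- <- <-]]].
        by have [] := H2 _ _ _ Hx; split; left.
      by split; [exact: set_valP|exact: set_valP|right; apply: set_valP].
    - move=> x y D1x D1y; have [[Dx Dy]|nxy] := pselect (DH x /\ DH y).
        by have [z Hz] := H3 _ _ Dx Dy; exists z; left.
      pose u := (SigSub (mem_set D1x) : D1, SigSub (mem_set D1y) : D1).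
      by exists (val (k u)); right; exists u.
  apply: (Gmax (H `|` N)); last first.
    by rewrite setUA (_ : G0 `|` H = H) // /H setUA setUid.
  split; first by move=> x Gx; left; right.
  move=> HNG; have [f _] := natDH; have D'x : D' (val (h (f 0))) by exists (f 0).
  have D1x : D1 (val (h (f 0))) by right.
  pose u := SigSub (mem_set D1x) : D1.
  apply: (D'E _ D'x); exists (val (k (u, u))); right; apply: HNG; right.
  by exists (u, u) => //= -[] /(D'E _ D'x).
apply: embeds_trans (embeds_prod XDH XDH) (embeds_trans sqDH _).
exact: embeds_set.
Qed.

Lemma embeds_sum_infinite X Y Z : nat ≼ X -> Y ≼ X -> Z ≼ X -> Y + Z ≼ X.
Proof.
move=> natX [f fI] [g gI]; apply: embeds_trans (embeds_square natX).
apply: embeds_trans (embeds_prod natX (embeds_refl X)).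
exists (fun z => match z with inl y => (0, f y) | inr z => (1, g z) end).
by move=> [y|z] [y'|z'] // [] => [/fI|/gI] ->.
Qed.

(** * Well-orders and trees with few nodes *)

Lemma cantor X : ~ ((X -> bool) ≼ X).
Proof.
move=> [f fI]; pose g x := `[< exists2 h, f h = x & ~~ h x >].
case E : (g (f g)).
  by move/asboolP: (E) => [h /fI ->]; rewrite E.
by move/asboolPn: (negbT E) => []; exists g; rewrite ?E.
Qed.

(** This replaces transfinite recursion: a maximal admissible set has no proper
   admissible extension, hence it is too large to embed into [F]. *)
Lemma zorn_extension (U F : Type) (ok : set (set U)) :
  (forall C, C `<=` ok -> total_on C subset -> ok (\bigcup_(A in C) A)) ->
  (forall A : set U, ok A -> A ≼ F -> exists2 e, ~ A e & ok (A `|` [set e])) ->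
  exists2 A : set U, ok A & ~ (A ≼ F).
Proof.
move=> okU ext; have [A [okA Amax]] := Zorn_bigcup okU.
exists A => // /(ext A okA)[e nAe]; apply: Amax; split; first exact: subsetUl.
by move=> /(_ e); apply: contra_not nAe; apply; right.
Qed.

Section Cutoff.
Variables (W : eqType) (lt : rel W).

(** The node of level [w] on the branch [s]. It is a function on all levels,
   false from [w] on, so that nodes of different levels have the same type. *)
Definition cutoff (s : W -> bool) (w : W) : W -> bool :=
  fun v => lt v w && s v.

Definition strict_well_order := [/\ irreflexive lt, transitive lt,
  forall x y, [|| x == y, lt x y | lt y x] &
  forall A : set W, A !=set0 -> exists2 x, A x & forall y, A y -> ~~ lt y x].

End Cutoff.

Lemma exists_strict_well_order X :
  exists lt : rel {classic X}, strict_well_order lt.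
Proof.
have [R Rwo] := @well_ordering_principle {classic X}.
have Rwo' : wo_chain R predT by move=> A _; apply: Rwo.
have Rxx x : R x x by apply: (wo_chain_reflexive Rwo').
have Ranti x y : R x y -> R y x -> x = y.
  by move=> xy yx; apply: (wo_chain_antisymmetric Rwo'); rewrite ?xy.
have Rtot x y : R x y || R y x by apply: (wo_chainW Rwo').
have Rtr : transitive R.
  move=> y x z xy yz.
  have [|t [[/or3P[]/eqP-> tmin] _]] :=
    Rwo [pred u | [|| u == x, u == y | u == z]].
  - by exists x; rewrite inE eqxx.
  - by apply: tmin; rewrite !inE eqxx !orbT.
  - have yx : R y x by apply: tmin; rewrite !inE eqxx.
    by rewrite (Ranti _ _ xy yx).
  - have zy : R z y by apply: tmin; rewrite !inE eqxx !orbT.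
    by rewrite -(Ranti _ _ yz zy).
exists (fun x y => R x y && (x != y)); split.
- by move=> x; rewrite eqxx andbF.
- move=> y x z /andP[xy nxy] /andP[yz nyz]; rewrite (Rtr _ _ _ xy yz) /=.
  by apply: contra_neqN nxy => /eqP e; subst; apply/Ranti.
- by move=> x y; rewrite eq_sym; case: eqVneq => //= _; rewrite !andbT.
- move=> A [x Ax]; have [|t [[tA tmin] _]] := Rwo [pred u | `[< A u >]].
    by exists x; apply/asboolP.
  exists t; first exact/asboolP.
  move=> y Ay; apply/negP => /andP[yt /eqP]; apply.
  by apply: Ranti yt _; apply: tmin; apply/asboolP.
Qed.

(** Every infinite [X] carries the levels of a binary tree with few nodes and
   many branches: the height is the least ordinal of which the power set does
   not embed into [X]. *)
Lemma exists_wide_tree X : nat ≼ X -> exists (W : eqType) (lt : rel W),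
  [/\ strict_well_order lt, W ≼ X, ~ ((W -> bool) ≼ X) &
      [set (w, cutoff lt s w) | w in setT & s in setT] ≼ X].
Proof.
move=> natX; suff [W [lt [ltP WX nWX segX]]] : exists (W : eqType) (lt : rel W),
    [/\ strict_well_order lt, W ≼ X, ~ ((W -> bool) ≼ X) &
        forall w, range (cutoff lt ^~ w) ≼ X].
  exists W, lt; split=> //; have [f fI] := WX.
  pose g w := projT1 (cid (segX w)).
  have gI w : injective (g w) := projT2 (cid (segX w)).
  apply: embeds_trans (embeds_square natX).
  have /choice[h hP] (z : [set (w, cutoff lt s w) | w in setT & s in setT]) :
      exists v : {w & range (cutoff lt ^~ w)},
        val z = (projT1 v, val (projT2 v)).
    have [w _ [s _ <-]] := set_valP z.
    have r : range (cutoff lt ^~ w) (cutoff lt s w) by exists s.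
    by exists (existT _ w (SigSub (mem_set r))).
  exists (fun z => (f (projT1 (h z)), g _ (projT2 (h z)))) => z z'.
  have := hP z; have := hP z'; case: (h z) => w u; case: (h z') => w' u' /=.
  move=> e' e [/fI ww']; move: u e; rewrite ww' => u e /gI uu'.
  by apply: val_inj; rewrite /= e e' uu'.
have [lt ltP] := exists_strict_well_order X.
have [allX|/existsNP[x0 nx0]] := pselect (forall x, range (cutoff lt ^~ x) ≼ X).
  by exists {classic X}, lt; split=> //; [exact: embeds_refl|exact: cantor].
have [irr tr tot wf] := ltP.
have [x nx xmin] := wf [set x | ~ range (cutoff lt ^~ x) ≼ X] (ex_intro _ x0 nx0).
pose W := {v : {classic X} | lt v x}; exists W, (relpre val lt); split.
- split=> [v|u v w|v w|A [a Aa]]; [exact: irr|exact: tr|exact: tot|].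
  have [|_ [b Ab <-] bmin] := wf [set val a | a in A]; first by exists (val a), a.
  by exists b => // c Ac; apply: bmin; exists c.
- by exists val; apply: val_inj.
- apply: contra_not nx; apply: embeds_trans.
  exists (fun f v => val f (val v)) => -[f fP] [g gP] /= fg.
  apply: val_inj; apply: funext => v /=.
  have [[s _ fE] [t _ gE]] := (set_mem fP, set_mem gP); rewrite -fE -gE in fg *.
  case vx : (lt v x); last by rewrite /cutoff vx.
  exact: (congr1 (@^~ (exist _ v vx : W)) fg).
- move=> w; have /contrapT := contraTnot (xmin (val w)) (valP w).
  apply: embeds_trans; pose e (f : W -> bool) v := oapp f false (insub v).
  have eP (f : range (cutoff (relpre val lt) ^~ w)) :
      range (cutoff lt ^~ (val w)) (e (val f)).
    exists (e (val f)) => //; apply: funext => v; rewrite /cutoff /e.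
    have [s _ <-] := set_valP f.
    by case: insubP => [v' _ <-|_] /=; rewrite ?andbF // /cutoff andbA andbb.
  exists (fun f => SigSub (mem_set (eP f))) => f g /(congr1 val) /= efg.
  apply: val_inj; apply: funext => v.
  by have := congr1 (@^~ (val v)) efg; rewrite /e /= valK.
Qed.

(** * Semantics of formulas and size of the language *)

Section Basics.
Variables (L : signature) (M : structure L).

Lemma eval_rename (V W : Type) (h : V -> W) (t : term L V) (v : W -> M) :
  eval v (trename h t) = eval (v \o h) t.
Proof.
by elim: t => //= f ts IH; congr finterp; apply: funext => i; apply: IH.
Qed.

Lemma sat_rename (V W : Type) (h : V -> W) (p : form L V) (v : W -> M) :
  sat (rename h p) v = sat p (v \o h).
Proof.
elim: p W h v => //=.
- by move=> U s t W h v; rewrite !eval_rename.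
- move=> U r ts W h v; congr (rinterp _); apply/funext => i; exact: eval_rename.
- by move=> U p IHp q IHq W h v; rewrite IHp IHq.
- by move=> U p IHp q IHq W h v; rewrite IHp IHq.
- move=> U p IHp W h v; apply: eq_exists => c.
  by rewrite IHp; congr sat; apply: funext => -[].
Qed.

Lemma sat_inst (X Y P : Type) (p : form L (X + Y)) (b : Y -> P)
    (x : X -> M) (v : P -> M) :
  sat (inst p b) (join x v) = sat p (join x (v \o b)).
Proof. by rewrite sat_rename; congr sat; apply: funext => -[]. Qed.

Definition ord_sum_option m (V : Type) (z : 'I_m.+1 + V) : option ('I_m + V) :=
  match z with inl i => omap inl (unlift ord0 i) | inr v => Some (inr v) end.

Fixpoint exs m (V : Type) : form L ('I_m + V) -> form L V :=
  match m with
  | 0 => rename (fun z : 'I_0 + V => match z with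
                 | inl i => False_rect V (notF (ltn_ord i))
                 | inr v => v end)
  | m'.+1 => fun p => @exs m' V (Ex (rename (@ord_sum_option m' V) p))
  end.

Lemma sat_exs m (V : Type) (p : form L ('I_m + V)) (v : V -> M) :
  sat (exs p) v <-> exists a, sat p (join a v).
Proof.
elim: m p => [|m IHm] p /=.
  rewrite sat_rename; split=> [pv|[a pa]].
    have [x0] := carrier_inhabited M; exists (fun=> x0).
    by congr (sat p _): pv; apply: funext => -[[]|].
  by congr (sat p _): pa; apply: funext => -[[]|].
rewrite IHm /=; split=> [[a [c]]|[a pa]].
  rewrite sat_rename => pa; exists (fun i => oapp a c (unlift ord0 i)).
  by congr (sat p _): pa; apply: funext => -[i|] //=; case: unliftP.
exists (a \o lift ord0), (a ord0); rewrite sat_rename.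
by congr (sat p _): pa; apply: funext => -[i|] //=; case: unliftP => [j|] ->.
Qed.

End Basics.

Section Language.
Variable L : signature.
Local Notation F := (form L nat).

Definition var_eq (k : nat) : F := Eq (Var L k) (Var L k).

Lemma nat_embeds_form : nat ≼ F.
Proof. by exists var_eq => x y []. Qed.

(** The syntax itself pairs formulas, whence the absorption laws of the cardinal
   [|T|]. *)
Lemma formX_embeds : F * F ≼ F.
Proof. by exists (fun z => And z.1 z.2) => -[a b] [c d] [-> ->]. Qed.

Lemma formD_embeds : F + F ≼ F.
Proof.
exists (fun z => match z with inl a => And a (Top) | inr a => Or a Top end).
by move=> [a|a] [b|b] // [->].
Qed.

Lemma seq_form_embeds : seq F ≼ F.
Proof.
exists (foldr (@And L nat) Top) => s t; elim: s t => [|x s IHs] [|y t] //=.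
by move=> [-> /IHs ->].
Qed.

Lemma seq_embeds X : X ≼ F -> seq X ≼ F.
Proof.
move=> [f fI]; apply: embeds_trans seq_form_embeds.
by exists (map f); apply: inj_map.
Qed.

Lemma prod_embeds X Y : X ≼ F -> Y ≼ F -> X * Y ≼ F.
Proof. by move=> XF YF; apply: embeds_trans (embeds_prod XF YF) formX_embeds. Qed.

Lemma setU_embeds X (A B : set X) : A ≼ F -> B ≼ F -> (A `|` B : set X) ≼ F.
Proof.
move=> AF BF; apply: embeds_trans (embeds_setU A B) _.
exact: embeds_trans (embeds_sum AF BF) formD_embeds.
Qed.

Lemma unit_embeds : unit ≼ F.
Proof. by exists (fun=> Top) => -[] []. Qed.

Lemma set1_embeds X (x : X) : [set x] ≼ F.
Proof.
apply: embeds_trans unit_embeds; exists (fun=> tt) => -[y yx] [z zx] _.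
by apply: val_inj => /=; rewrite (set_mem yx) (set_mem zx).
Qed.

Lemma ord_embeds n : 'I_n ≼ F.
Proof. by apply: embeds_trans nat_embeds_form; exists val; apply: val_inj. Qed.

Lemma existT_inj (I : Type) (P : I -> Type) i (a b : P i) :
  existT P i a = existT P i b -> a = b.
Proof.
move=> e; have /= := projT2_eq e.
by rewrite (Prop_irrelevance (projT1_eq e) (erefl i)).
Qed.

Lemma trename_inj (V W : Type) (h : V -> W) : injective h ->
  injective (@trename L V W h).
Proof.
move=> hI; elim=> [x|f ts IH] [y|g us] //= [].
  by move=> /hI ->.
move=> fg; move: us; rewrite -{}fg => us e; have tsus := existT_inj e.
by congr App; apply: funext => i; apply: IH; apply: (congr1 (@^~ i) tsus).
Qed.

Lemma rename_inj (V W : Type) (h : V -> W) : injective h ->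
  injective (@rename L V W h).
Proof.
move=> hI p; elim: p W h hI => {V}
  [V|V|V s t|V r ts|V p IHp q IHq|V p IHp q IHq|V p IHp] W h hI
  [||s' t'|r' us|p' q'|p' q'|p'] //=.
- by move=> [/(trename_inj hI) -> /(trename_inj hI) ->].
- move=> [rr']; move: us; rewrite -{}rr' => us e; have tsus := existT_inj e.
  congr Rel; apply: funext => i; apply: (trename_inj hI).
  exact: (congr1 (@^~ i) tsus).
- by move=> [/(IHp _ _ hI) -> /(IHq _ _ hI) ->].
- by move=> [/(IHp _ _ hI) -> /(IHq _ _ hI) ->].
- move=> [] /IHp -> //; exact: inj_omap.
Qed.

Lemma form_embeds (V : Type) : V ≼ nat -> form L V ≼ F.
Proof. by move=> [h hI]; exists (rename h); apply: rename_inj. Qed.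

Lemma form_ord_embeds m n : form L ('I_m + 'I_n) ≼ F.
Proof.
apply: form_embeds; exists (fun z => pickle z); exact: pcan_inj pickleK.
Qed.

End Language.

(** * Trees of finite height *)

Section Trees.
Variables (L : signature) (M : structure L) (m n : nat).
Implicit Types (phi psi : form L ('I_m + 'I_n)).
Implicit Types (P : set ('I_m -> M)) (Q : set ('I_n -> M)).

Definition fibre phi (b : 'I_n -> M) : set ('I_m -> M) :=
  [set a | sat phi (join a b)].

(** Leaves are taken in [P] and nodes in [Q]. The tree is hidden in the nested
   quantifiers; [has_tree_unfold] displays it. *)
Fixpoint has_tree phi psi P Q (k : nat) : Prop :=
  match k with
  | 0 => P !=set0
  | k'.+1 => exists b, [/\ Q b, has_tree phi psi (P `&` fibre phi b) Q k' &
                           has_tree phi psi (P `&` fibre psi b) Q k']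
  end.

Lemma has_treeW phi psi P Q P' Q' k j : P `<=` P' -> Q `<=` Q' -> j <= k ->
  has_tree phi psi P Q k -> has_tree phi psi P' Q' j.
Proof.
move=> PP' QQ'; elim: j k P P' PP' => [|j IHj] k P P' PP' /= jk.
  case: k jk => [|k] jk /=; first by move=> [a /PP' Pa]; exists a.
  move=> [b [_ + _]]; elim: k b P PP' {jk} => [|k IHk] b P PP' /=.
    by move=> [a [/PP' Pa _]]; exists a.
  by move=> [c [_ + _]]; apply: IHk => a [/PP'].
case: k jk => // k jk /= [b [Qb t1 t2]]; exists b; split; first exact: QQ'.
  by apply: IHj t1 => //; apply: setSI.
by apply: IHj t2 => //; apply: setSI.
Qed.

(** Weakening: in [skip_mid] and [skip_last] the quantified tuple [Y] comes
   between the tuple [X] and the parameters [V]. *)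
Definition skip_mid (X Y V : Type) (p : form L (X + V)) : form L (X + (Y + V)) :=
  rename (fun z => match z with inl x => inl x | inr v => inr (inr v) end) p.

Definition skip_last (X Y V : Type) (p : form L (X + Y)) : form L (X + (Y + V)) :=
  rename (fun z => match z with inl x => inl x | inr y => inr (inl y) end) p.

(** Positive formulas are closed under the quantifiers of [has_tree], which makes
   saturation applicable to heights. *)
Fixpoint tree_form phi psi (V : Type) (theta : form L ('I_m + V))
    (kappa : form L ('I_n + V)) (k : nat) : form L V :=
  match k with
  | 0 => exs theta
  | k'.+1 => exs (And kappa (And
      (tree_form phi psi (And (skip_mid 'I_n theta) (skip_last V phi)) (skip_mid 'I_n kappa) k')
      (tree_form phi psi (And (skip_mid 'I_n theta) (skip_last V psi)) (skip_mid 'I_n kappa) k')))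
  end.

Lemma sat_skip_mid (X Y V : Type) (p : form L (X + V)) (x : X -> M)
    (y : Y -> M) (v : V -> M) :
  sat (skip_mid Y p) (join x (join y v)) = sat p (join x v).
Proof. by rewrite sat_rename; congr sat; apply: funext => -[]. Qed.

Lemma sat_skip_last (X Y V : Type) (p : form L (X + Y)) (x : X -> M)
    (y : Y -> M) (v : V -> M) :
  sat (skip_last V p) (join x (join y v)) = sat p (join x y).
Proof. by rewrite sat_rename; congr sat; apply: funext => -[]. Qed.

Lemma sat_tree_form phi psi (V : Type) (theta : form L ('I_m + V))
    (kappa : form L ('I_n + V)) (k : nat) (v : V -> M) :
  sat (tree_form phi psi theta kappa k) v <->
  has_tree phi psi [set a | sat theta (join a v)]
    [set b | sat kappa (join b v)] k.
Proof.
elim: k V theta kappa v => [|k IHk] V theta kappa v /=; first exact: sat_exs.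
have Qb b : [set b' | sat (skip_mid 'I_n kappa) (join b' (join b v))] =
    [set b' | sat kappa (join b' v)].
  by apply: funext => b' /=; rewrite sat_skip_mid.
have Pb chi b :
    [set a | sat (And (skip_mid 'I_n theta) (skip_last V chi)) (join a (join b v))]
    = [set a | sat theta (join a v)] `&` fibre chi b.
  by apply: funext => a /=; rewrite sat_skip_mid sat_skip_last.
rewrite sat_exs; split=> -[b bP]; exists b; move: bP => /=; rewrite !IHk Qb !Pb.
  by move=> [? []].
by move=> [].
Qed.

(** A tree of height [k], unfolded: the nodes [b] and leaves [a] are indexed by
   the sequences of booleans. *)
Lemma has_tree_unfold phi psi P Q k : has_tree phi psi P Q k ->
  exists (b : seq bool -> 'I_n -> M) (a : seq bool -> 'I_m -> M),
    forall s, size s = k -> P (a s) /\ forall i, i < k ->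
      sat (if nth false s i then psi else phi) (join (a s) (b (take i s))).
Proof.
have [x0] := carrier_inhabited M.
elim: k P => [|k IHk] P /=.
  by move=> [a Pa]; exists (fun _ _ => x0), (fun=> a) => s _; split.
move=> [b [_ /IHk[b1 [a1 t1]] /IHk[b2 [a2 t2]]]].
exists (fun s => if s is x :: s' then if x then b2 s' else b1 s' else b).
exists (fun s => if head false s then a2 (behead s) else a1 (behead s)).
move=> [|[] s] //= [sk].
  have [[Pa pa] ta] := t2 _ sk; split=> // -[|i] //= ik; exact: ta.
have [[Pa pa] ta] := t1 _ sk; split=> // -[|i] //= ik; exact: ta.
Qed.

End Trees.

Section Saturation.
Variables (L : signature) (T : theory L) (K : Type) (M : structure L).
Hypothesis mon : monster T K M.
Local Notation F := (form L nat).

Lemma small_embeds X Y : small K [set: Y] -> X ≼ Y -> small K [set: X].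
Proof.
move=> [YK KY] /card_leTE XY; split; first exact: card_le_trans XY YK.
by apply: contra_not KY => /card_le_trans; apply.
Qed.

Lemma small_form X : X ≼ F -> small K [set: X].
Proof. exact: small_embeds (monster_language mon). Qed.

Lemma saturate_small (X I : Type) (f : I -> form L (X + M)) :
  small K [set: X] -> small K [set: I] ->
  (forall s : seq I, exists a : X -> M, forall i, List.In i s -> sat (f i) (join a id)) ->
  exists a : X -> M, forall i, sat (f i) (join a id).
Proof.
move=> Xs [IK KI] fin; have := @monster_saturated _ _ _ _ mon X (range f) Xs.
case=> [|D Df Dfin|a aP].
- split; first exact: card_le_trans (card_image_le _ _) IK.
  by apply: contra_not KI => /card_le_trans; apply; apply: card_image_le.
- have : exists s : seq I, forall chi, D chi -> exists2 i, List.In i s & f i = chi.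
    have /(@finite_seqP {classic _})[l Dl] := Dfin.
    have {Df} : forall chi, chi \in l -> exists i, f i = chi.
      by move=> chi cl; have [|i _ <-] := Df chi; [rewrite Dl|exists i].
    rewrite {}Dl; elim: l {Dfin} => [|c l IHl] lP; first by exists [::].
    have [|s sP] := IHl; first by move=> chi cl; apply: lP; rewrite inE cl orbT.
    have [|i ic] := lP c; first by rewrite inE eqxx.
    exists (i :: s) => chi /=; rewrite inE => /orP[/eqP->|/sP[j js <-]].
      by exists i => //; left.
    by exists j => //; right.
  move=> [s sP]; have [a aP] := fin s; exists a => chi /sP[i si <-].
  exact: aP.
- by exists a => i; apply: aP; exists i.
Qed.

(** Existential closedness speaks of variables indexed by an ordinal, and this
   transports it to the two tuples [x] and [y]. *)
Lemma ec_negation m n (phi : form L ('I_m + 'I_n)) (a : 'I_m -> M) (b : 'I_n -> M) :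
  ~ sat phi (join a b) ->
  exists2 psi, negation T phi psi & sat psi (join a b).
Proof.
move=> nphi; have [_ /(_ (m + n) (rename (@unsplit m n) phi)
  (join a b \o @fintype.split m n))] := monster_ec mon.
case=> [|psi npsi psiab].
  by rewrite sat_rename; congr (~ sat _ _): nphi; apply: funext => z /=; rewrite unsplitK.
exists (rename (@fintype.split m n) psi); last by rewrite sat_rename.
move=> N TN [v []]; rewrite sat_rename => vphi vpsi.
apply: (npsi N TN); exists (v \o @fintype.split m n); split=> //.
by rewrite sat_rename; congr (sat _ _): vphi; apply: funext => z /=; rewrite unsplitK.
Qed.

Lemma negation_disjoint (V : Type) (phi psi : form L V) (v : V -> M) :
  negation T phi psi -> sat phi v -> ~ sat psi v.
Proof.
by move=> /(_ _ (monster_ec mon).1) npsi vphi vpsi; apply: npsi; exists v.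
Qed.

End Saturation.

(** * Good sets of constraints *)

Lemma In_cat X (x : X) (s t : seq X) :
  List.In x (s ++ t) <-> List.In x s \/ List.In x t.
Proof. exact: List.in_app_iff. Qed.

Section Good.
Variables (L : signature) (T : theory L) (K : Type) (M : structure L).
Hypothesis mon : monster T K M.
Variables (m n : nat) (phi psi : form L ('I_m + 'I_n)).
Local Notation F := (form L nat).

(** Constraints [inl theta] on the leaves and [inr kappa] on the nodes of a tree
   are of one type, so that a single finite part controls both. *)
Definition constraint : Type := (form L ('I_m + M) + form L ('I_n + M))%type.
Implicit Types (G : set constraint) (s : seq constraint).

Definition leaf_form s : form L ('I_m + M) :=
  foldr (fun c p => if c is inl theta then And theta p else p) Top s.
Definition node_form s : form L ('I_n + M) :=
  foldr (fun c p => if c is inr kappa then And kappa p else p) Top s.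

Definition leaves s : set ('I_m -> M) := [set a | sat (leaf_form s) (join a id)].
Definition nodes s : set ('I_n -> M) := [set b | sat (node_form s) (join b id)].

Definition part G s : Prop := forall c, List.In c s -> G c.

(** This replaces tall subtrees. Since it is a condition on the finite parts it
   passes to unions of chains, and by saturation one node splits all the finite
   parts at once ([good_split]). *)
Definition good G : Prop :=
  forall s, part G s -> forall k, has_tree phi psi (leaves s) (nodes s) k.

Definition leaf_of G : set ('I_m -> M) :=
  [set a | forall theta, G (inl theta) -> sat theta (join a id)].
Definition node_of G : set ('I_n -> M) :=
  [set b | forall kappa, G (inr kappa) -> sat kappa (join b id)].

Lemma leavesP s a :
  leaves s a <-> forall theta, List.In (inl theta) s -> sat theta (join a id).
Proof.
elim: s => [|[p|p] s IHs] /=; first by split.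
  split=> [[pa /IHs sa] theta [[<-]|/sa]//|sa].
  by split; [apply: sa; left|apply/IHs => theta ths; apply: sa; right].
split=> [/IHs sa theta [|/sa]//|sa].
by apply/IHs => theta ths; apply: sa; right.
Qed.

Lemma nodesP s b :
  nodes s b <-> forall kappa, List.In (inr kappa) s -> sat kappa (join b id).
Proof.
elim: s => [|[p|p] s IHs] /=; first by split.
  split=> [/IHs sa theta [|/sa]//|sa].
  by apply/IHs => theta ths; apply: sa; right.
split=> [[pa /IHs sa] theta [[<-]|/sa]//|sa].
by split; [apply: sa; left|apply/IHs => theta ths; apply: sa; right].
Qed.

Lemma leaves_sub s t : (forall c, List.In c s -> List.In c t) ->
  leaves t `<=` leaves s.
Proof. by move=> st a /leavesP at_; apply/leavesP => theta /st/at_. Qed.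

Lemma nodes_sub s t : (forall c, List.In c s -> List.In c t) ->
  nodes t `<=` nodes s.
Proof. by move=> st a /nodesP at_; apply/nodesP => theta /st/at_. Qed.

Lemma goodS G G' : G `<=` G' -> good G' -> good G.
Proof. by move=> GG' gG s sG k; apply: gG => c /sG/GG'. Qed.

Lemma good_chain (C : set (set constraint)) G : total_on C subset -> good G ->
  (forall A, C A -> good (G `|` A)) -> good (G `|` \bigcup_(A in C) A).
Proof.
move=> Ctot gG Cg s sC k.
suff : part G s \/ exists2 A, C A & part (G `|` A) s.
  by case=> [/gG|[A /Cg gA /gA]].
elim: s sC => [|c s IHs] sC; first by left.
have [|sG|[A CA sA]] := IHs; first by move=> d ds; apply: sC; right.
  have [Gc|[A CA Ac]] := sC c (or_introl erefl).
    by left=> d [<-|/sG].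
  by right; exists A => // d [<-|/sG]; [right|left].
have [Gc|[B CB Bc]] := sC c (or_introl erefl).
  by right; exists A => // d [<-|/sA]; first by left.
have [AB|BA] := Ctot _ _ CA CB.
  by right; exists B => // d [<-|/sA[Gd|/AB Bd]]; [right|left|right].
by right; exists A => // d [<-|/sA//]; right; apply: BA.
Qed.

Lemma part_setU1 G c s : part (G `|` [set c]) s ->
  exists2 t, part G t & forall d, List.In d s -> d = c \/ List.In d t.
Proof.
elim: s => [|d s IHs] sG; first by exists [::].
have [|t tG st] := IHs; first by move=> e es; apply: sG; right.
have [Gd|dc] := sG d (or_introl erefl).
  exists (d :: t) => [e [<-//|/tG//]|e [<-|/st[->|te]]]; first by right; left.
    by left.
  by right; right.
by exists t => // e [<-|/st//]; left.
Qed.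

Lemma not_good G c : ~ good (G `|` [set c]) ->
  exists s k, part G s /\ ~ has_tree phi psi (leaves (c :: s)) (nodes (c :: s)) k.
Proof.
move=> /existsNP[s /not_implyP[sG /existsNP[k ns]]].
have [t tG st] := part_setU1 sG.
exists t, k; split=> //; apply: contra_not ns; apply: has_treeW => //.
  by apply: leaves_sub => d /st[->|dt]; [left|right].
by apply: nodes_sub => d /st[->|dt]; [left|right].
Qed.

Definition on_left (b : 'I_n -> M) : constraint := inl (inst phi b).
Definition on_right (b : 'I_n -> M) : constraint := inl (inst psi b).

Lemma leaves_inst chi s (b : 'I_n -> M) :
  leaves (inl (inst chi b) :: s) = leaves s `&` fibre chi b.
Proof.
apply/seteqP; rewrite /leaves; split=> a /=; rewrite sat_inst; tauto.
Qed.

(** Compactness turns the trees of all finite heights into a node splitting the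
   whole set of constraints. *)
Lemma good_split G : G ≼ F -> good G -> exists b,
  [/\ node_of G b, good (G `|` [set on_left b]) & good (G `|` [set on_right b])].
Proof.
move=> GF gG.
pose part_of (s : seq G) := map (@set_val _ G) s.
have partP (s : seq G) : part G (part_of s).
  by elim: s => //= c s IHs d [<-|/IHs//]; apply: set_valP.
have partS s : part G s -> exists t, part_of t = s.
  elim: s => [|c s IHs] sG; first by exists [::].
  have [|t <-] := IHs; first by move=> d ds; apply: sG; right.
  by exists (SigSub (mem_set (sG c (or_introl erefl))) :: t).
pose f (z : seq G * nat) : form L ('I_n + M) :=
  And (node_form (part_of z.1)) (And
   (tree_form phi psi (And (skip_mid 'I_n (leaf_form (part_of z.1))) (skip_last M phi))
     (skip_mid 'I_n (node_form (part_of z.1))) z.2)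
   (tree_form phi psi (And (skip_mid 'I_n (leaf_form (part_of z.1))) (skip_last M psi))
     (skip_mid 'I_n (node_form (part_of z.1))) z.2)).
have fP z b : sat (f z) (join b id) <->
  [/\ nodes (part_of z.1) b,
    has_tree phi psi (leaves (part_of z.1) `&` fibre phi b) (nodes (part_of z.1)) z.2 &
    has_tree phi psi (leaves (part_of z.1) `&` fibre psi b) (nodes (part_of z.1)) z.2].
  have Qb : [set b' | sat (skip_mid 'I_n (node_form (part_of z.1))) (join b' (join b id))]
      = nodes (part_of z.1) by apply: funext => b' /=; rewrite sat_skip_mid.
  have Pb chi : [set a | sat (And (skip_mid 'I_n (leaf_form (part_of z.1))) (skip_last M chi))
      (join a (join b id))] = leaves (part_of z.1) `&` fibre chi b.
    by apply: funext => a /=; rewrite sat_skip_mid sat_skip_last.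
  by rewrite /= !sat_tree_form Qb !Pb; split=> [[? []]|[]].
have [|||b bP] := saturate_small mon (f := f).
- exact: small_form mon _ (ord_embeds _ _).
- apply: (small_form mon); apply: prod_embeds; last exact: nat_embeds_form.
  exact: seq_embeds.
- move=> l; pose s := flatten (map fst l); pose k := \max_(z <- l) z.2.
  have [b [Qb tl tr]] := gG _ (partP s) k.+1.
  have sub z : List.In z l -> forall c, List.In c (part_of z.1) -> List.In c (part_of s).
    rewrite /s; elim: (l) => //= y l' IHl [->|zl] c cz; rewrite /part_of map_cat.
      by apply/In_cat; left.
    by apply/In_cat; right; apply: IHl zl _ cz.
  have lek z : List.In z l -> z.2 <= k.
    rewrite /k; elim: (l) => //= y l' IHl [->|zl]; rewrite big_cons leq_max ?leqnn //.
    by rewrite IHl ?orbT.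
  exists b => z zl; apply/fP; split; first exact: nodes_sub (sub z zl) _ Qb.
    apply: has_treeW tl => //; last exact: lek.
      exact: setSI (leaves_sub (sub z zl)).
    exact: nodes_sub (sub z zl).
  apply: has_treeW tr => //; last exact: lek.
    exact: setSI (leaves_sub (sub z zl)).
  exact: nodes_sub (sub z zl).
exists b; split.
- move=> kappa Gk; have [|t tE] := partS [:: inr kappa]; first by move=> c [<-|].
  have /fP[+ _ _] := bP (t, 0); rewrite /= tE => /nodesP; apply.
  by left.
- apply: contrapT => /not_good[s [k [/partS[t ts] ns]]]; apply: ns.
  by have /fP[_ + _] := bP (t, k); rewrite leaves_inst /= ts.
- apply: contrapT => /not_good[s [k [/partS[t ts] ns]]]; apply: ns.
  by have /fP[_ _ +] := bP (t, k); rewrite leaves_inst /= ts.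
Qed.

Lemma good_leaf G : G ≼ F -> good G -> leaf_of G !=set0.
Proof.
move=> GF gG; pose f (z : G) := if val z is inl theta then theta else Top.
have [|||a aP] := saturate_small mon (f := f).
- exact: small_form mon _ (ord_embeds _ _).
- exact: (small_form mon).
- move=> l; have [a /leavesP aP] : leaves (map val l) !=set0.
    apply: (gG _ _ 0).
    by elim: l => //= z l IHl c [<-|/IHl//]; apply: set_valP.
  exists a => z zl; rewrite /f; case E : (val z) => [theta|] //.
  by apply: aP; rewrite -E; apply: List.in_map.
exists a => theta Gt.
exact: (aP (SigSub (mem_set Gt))).
Qed.

Definition inst_leaf (chi : form L ('I_m + 'I_n)) (c : 'I_m -> M) :
    form L ('I_n + M) :=
  rename (fun z => match z with inl x => inr (c x) | inr y => inl y end) chi.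

Lemma sat_inst_leaf chi (c : 'I_m -> M) (b : 'I_n -> M) :
  sat (inst_leaf chi c) (join b id) = sat chi (join c b).
Proof. by rewrite sat_rename; congr sat; apply: funext => -[]. Qed.

(** The possible relations between a leaf [c] and a node [b]: in an existentially
   closed model one of them always holds ([ec_negation]). *)
Definition colour (chi : form L ('I_m + 'I_n)) := chi = phi \/ negation T phi chi.

Definition blocked G (c : 'I_m -> M) chi := ~ exists b,
  [/\ node_of G b, sat chi (join c b), good (G `|` [set on_left b]) &
      good (G `|` [set on_right b])].

Lemma blockedS G G' c chi : G `<=` G' -> blocked G c chi -> blocked G' c chi.
Proof.
move=> GG'; apply: contra_not => -[b [Gb cb gl gr]]; exists b; split=> //.
- by move=> kappa /GG'; apply: Gb.
- by apply: goodS gl; apply: setSU.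
- by apply: goodS gr; apply: setSU.
Qed.

Definition elements s : set constraint := [set d | List.In d s].

(** If, in every good finite extension, some node related to [c] by [chi] still
   splits, these nodes make up trees of all heights, all nodes of which are
   related to [c] by [chi]. *)
Lemma exists_blocked G (c : 'I_m -> M) chi : good G ->
  ~ good (G `|` [set inr (inst_leaf chi c)]) ->
  exists2 s, good (G `|` elements s) & blocked (G `|` elements s) c chi.
Proof.
move=> gG; apply: contra_notP => /forall2NP nblocked t tG k.
have {nblocked} splits s : good (G `|` elements s) -> exists b,
    [/\ node_of (G `|` elements s) b, sat chi (join c b),
      good (G `|` elements s `|` [set on_left b]) &
      good (G `|` elements s `|` [set on_right b])].
  by move=> gs; have [//|/contrapT] := nblocked s.
have [t' t'G tt'] := part_setU1 tG.
suff tree s : good (G `|` elements s) ->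
    has_tree phi psi (leaves t `&` leaves s) (nodes t) k.
  apply: has_treeW (tree [::] _) => //; apply: goodS gG.
  by move=> d [].
elim: k s => [|k IHk] s gs.
  have [a /leavesP aP] : leaves (t' ++ s) !=set0.
    by apply: (gs _ _ 0) => d /In_cat[/t'G|]; [left|right].
  exists a; split; apply/leavesP => theta th; apply: aP; apply/In_cat.
    by have [//|] := tt' _ th; left.
  by right.
have [b [Gb cb gl gr]] := splits s gs; exists b; split.
- apply/nodesP => kappa /tt'[[->]|/t'G Gk]; first by rewrite sat_inst_leaf.
  by apply: Gb; left.
- rewrite -setIA -leaves_inst; apply: IHk; apply: goodS gl.
  by move=> d [Gd|[<-|sd]]; [left; left|right|left; right].
- rewrite -setIA -leaves_inst; apply: IHk; apply: goodS gr.
  by move=> d [Gd|[<-|sd]]; [left; left|right|left; right].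
Qed.

(** The nodes of a good set of constraints may be assumed to relate to [c] all
   in the same way [chi]. Otherwise, for each [chi], a finite extension stops
   the nodes related to [c] by [chi] from splitting. By Zorn's lemma these
   extensions can be made together, one for each [chi], hence with [|T|]
   constraints in all; then no node splits, against compactness. *)
Lemma good_colour G (c : 'I_m -> M) : G ≼ F -> good G ->
  exists2 chi, colour chi & good (G `|` [set inr (inst_leaf chi c)]).
Proof.
move=> GF gG; apply: contrapT => /forall2NP ncol.
have {}ncol chi : colour chi -> ~ good (G `|` [set inr (inst_leaf chi c)]).
  by move=> cchi; have [//|] := ncol chi.
pose U := (form L ('I_m + 'I_n) * seq constraint)%type.
pose S (A : set U) : set constraint := [set d | exists2 e, A e & List.In d e.2].
pose ok (A : set U) := [/\ forall e e', A e -> A e' -> e.1 = e'.1 -> e = e',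
  good (G `|` S A) & forall e, A e -> blocked (G `|` S A) c e.1].
have [||A [Afun _ _]] := @zorn_extension U F ok.
- move=> C Cok Ctot; have Sbig : S (\bigcup_(A in C) A) = \bigcup_(B in S @` C) B.
    apply/seteqP; split=> [d [e [A CA Ae] de]|d [_ [A CA <-] [e Ae de]]].
      by exists (S A); [exists A|exists e].
    by exists e => //; exists A.
  split.
  - move=> e e' [A CA Ae] [B CB Be'].
    have [D [/Cok[Dfun _ _] De De']] := chain_pair Ctot CA CB Ae Be'.
    exact: Dfun.
  - rewrite Sbig; apply: good_chain => // [_ _ [A CA <-] [B CB <-]|].
      by have [AB|BA] := Ctot _ _ CA CB; [left|right] => d [e Ae de]; exists e => //;
        [apply: AB|apply: BA].
    by move=> _ [A /Cok[_ gA _] <-].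
  - move=> e [A CA Ae]; have [_ _ /(_ e Ae)] := Cok _ CA; apply: blockedS.
    by apply: setUS => d [e' Ae' de']; exists e' => //; exists A.
- move=> A [Afun gA Ablock] AF.
  have SF : S A ≼ F.
    apply: embeds_trans (prod_embeds AF (nat_embeds_form L)).
    have /choice[h hP] (d : S A) : exists z : A * nat,
        List.nth_error (val z.1).2 z.2 = Some (val d).
      have [e Ae de] : S A (val d) := set_valP d.
      have [i ei] := List.In_nth_error _ _ de.
      by exists (SigSub (mem_set Ae), i).
    exists h => d d' dd'; apply: val_inj.
    by have := hP d; rewrite dd' hP => -[].
  have [b [Gb gl gr]] := good_split (setU_embeds GF SF) gA.
  have [chi cchi cb] : exists2 chi, colour chi & sat chi (join c b).
    have [cb|/(ec_negation mon)[chi nchi cb]] := pselect (sat phi (join c b)).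
      by exists phi => //; left.
    by exists chi => //; right.
  have nA s : ~ A (chi, s) by move=> /Ablock; apply; exists b.
  have [|s gs bs] := @exists_blocked (G `|` S A) c chi gA.
    by apply: contra_not (ncol chi cchi); apply: goodS; apply: setSU; left.
  have SAs : S (A `|` [set (chi, s)]) = S A `|` elements s.
    apply/seteqP; split=> d [].
    - by move=> e [Ae|->] de; [left; exists e|right].
    - by move=> [e Ae de]; exists e => //; left.
    - by move=> de; exists (chi, s) => //; right.
  exists (chi, s); first exact: nA.
  split; rewrite ?SAs ?setUA //.
  - move=> [x t] [y u] [Ae|[-> ->]] [Ae'|[-> ->]] //= xy.
    + exact: Afun.
    + by case: (nA t); rewrite -xy.
    + by case: (nA u); rewrite xy.
  - move=> e [/Ablock|->//]; apply: blockedS; exact: subsetUl.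
apply; apply: embeds_trans (form_ord_embeds L m n).
exists (fun e => (val e).1) => e e' ee'; apply: val_inj.
by apply: Afun ee'; apply: set_valP.
Qed.

End Good.

(** * From trees to the order property *)

Section Ladders.
Variables (L : signature) (T : theory L) (K : Type) (M : structure L).
Hypothesis mon : monster T K M.
Variables (m n : nat) (phi psi : form L ('I_m + 'I_n)).
Hypothesis neg_psi : negation T phi psi.
Local Notation F := (form L nat).
Implicit Types (alpha beta : form L ('I_m + 'I_n)).
Implicit Types (G : set (constraint M m n)).

(** Any element is comparable with all others, infinitely many of which lie on
   one side of it. They contain a long chain by induction, and the element is
   added to it as first or as last. *)
Lemma infinite_chain U (r : U -> U -> Prop) (A : set U) N : infinite_set A ->
  (forall e e', A e -> A e' -> e = e' \/ r e e' \/ r e' e) ->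
  exists2 f : nat -> U, forall i, A (f i) & forall i j, i < j -> j < N -> r (f i) (f j).
Proof.
elim: N A => [|N IHN] A Ainf Ar.
  by have [x Ax] := infinite_setN0 Ainf; exists (fun=> x).
have [x Ax] := infinite_setN0 Ainf.
pose A1 := [set e | A e /\ r x e]; pose A2 := [set e | A e /\ r e x].
have [A1fin|A1inf] := pselect (finite_set A1); last first.
  have [|f fA fr] := IHN A1 A1inf; first by move=> e e' [Ae _] [Ae' _]; apply: Ar.
  exists (fun i => if i is i'.+1 then f i' else x) => [[|i]//|[|i] [|j] //=].
  - by have [] := fA i.
  - by have [] := fA j.
  - by rewrite !ltnS; apply: fr.
have A2inf : infinite_set A2.
  move=> A2fin; apply: Ainf; apply: (@sub_finite_set _ _ (A1 `|` A2 `|` [set x])).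
    move=> e Ae; have [->|[rxe|rex]] := Ar x e Ax Ae; first by right.
      by left; left.
    by left; right.
  by rewrite !finite_setU; do !split => //; apply: finite_set1.
have [|f fA fr] := IHN A2 A2inf; first by move=> e e' [Ae _] [Ae' _]; apply: Ar.
exists (fun i => if i < N then f i else x) => [i|i j ij].
  by case: ifP => // _; have [] := fA i.
rewrite ltnS => jN; rewrite (leq_trans ij jN); case: (ltnP j N) => [|Nj]; first exact: fr.
by have [] := fA i.
Qed.

(** An entry [(b, c, beta)] of a ladder consists of a node [b], a leaf [c], and
   the formula [beta(c, y)] imposed on the nodes of later entries. The formula
   [alpha(x, b)] imposed on the leaves of later entries is the same for all. *)
Definition entry : Type :=
  (('I_n -> M) * ('I_m -> M) * form L ('I_m + 'I_n))%type.
Definition entry_leaf alpha (e : entry) : constraint M m n :=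
  inl (inst alpha e.1.1).
Definition entry_node (e : entry) : constraint M m n :=
  inr (inst_leaf e.2 e.1.2).
Definition before alpha (e e' : entry) : Prop :=
  sat alpha (join e'.1.2 e.1.1) /\ sat e.2 (join e.1.2 e'.1.1).

Definition entries alpha (A : set entry) : set (constraint M m n) :=
  (entry_leaf alpha @` A) `|` (entry_node @` A).

Lemma infinite_fibre (A : set entry) : ~ (A ≼ F) ->
  exists beta, infinite_set [set e | A e /\ e.2 = beta].
Proof.
move=> nAF; apply: contrapT => /forallNP fin; apply: nAF.
have count beta : exists f : [set e | A e /\ e.2 = beta] -> nat, injective f.
  have /contrapT := fin beta; move=> /finite_set_countable /card_leTr [f fI].
  by exists f.
pose g beta := projT1 (cid (count beta)).
have gI beta : injective (g beta) := projT2 (cid (count beta)).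
have inA (e : A) : [set e' | A e' /\ e'.2 = (val e).2] (val e).
  by split=> //; apply: set_valP.
apply: embeds_trans (prod_embeds (form_ord_embeds L m n) (nat_embeds_form L)).
exists (fun e => ((val e).2, g _ (SigSub (mem_set (inA e))))) => e e' [].
move: (inA e) (inA e'); set x := val e; set y := val e' => xA yA xy.
move: xA; rewrite xy => xA /gI/(congr1 val) /= exy.
exact: val_inj.
Qed.

(** As long as a ladder has at most [|T|] entries it can be prolonged, so some
   ladder has more; by the pigeonhole principle infinitely many of its entries
   use the same formula [beta]. An entry never prolongs a ladder to which
   it belongs already, since [alpha] and [beta] exclude each other. *)
Lemma uniform_ladder alpha (OK : set (form L ('I_m + 'I_n))) G0 :
  G0 ≼ F -> good phi psi G0 ->
  (forall beta v, OK beta -> sat alpha v -> ~ sat beta (v : _ -> M)) ->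
  (forall G, G0 `<=` G -> G ≼ F -> good phi psi G -> exists2 e : entry,
    [/\ OK e.2, leaf_of G e.1.2 & node_of G e.1.1] &
    good phi psi (G `|` entries alpha [set e])) ->
  exists2 beta, OK beta & forall N, exists (c : nat -> 'I_m -> M) (b : nat -> 'I_n -> M),
    forall i j, i < N -> j < N ->
      (j < i -> sat alpha (join (c i) (b j))) /\ (i < j -> sat beta (join (c i) (b j))).
Proof.
move=> G0F gG0 dis ext.
have entriesU A B : entries alpha (A `|` B) = entries alpha A `|` entries alpha B.
  by rewrite /entries !image_setU setUACA.
pose ok (A : set entry) := [/\ forall e, A e -> OK e.2,
  forall e e', A e -> A e' -> [\/ e = e', before alpha e e' | before alpha e' e] &
  good phi psi (G0 `|` entries alpha A)].
have [C Cok Ctot|A [AOK Abef gA] AF|A [AOK Abef _] nAF] := @zorn_extension entry F ok.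
- have big : entries alpha (\bigcup_(A in C) A) = \bigcup_(B in entries alpha @` C) B.
    apply/seteqP; split=> [d [[e [A CA Ae] <-]|[e [A CA Ae] <-]]|d [_ [A CA <-]]].
    + by exists (entries alpha A); [exists A|left; exists e].
    + by exists (entries alpha A); [exists A|right; exists e].
    + by move=> [[e Ae <-]|[e Ae <-]]; [left|right]; exists e => //; exists A.
  split.
  + by move=> e [A /Cok[AOK _ _]]; apply: AOK.
  + move=> e e' [A CA Ae] [B CB Be'].
    have [D [/Cok[_ Dbef _] De De']] := chain_pair Ctot CA CB Ae Be'.
    exact: Dbef.
  + rewrite big; apply: good_chain => // [_ _ [A CA <-] [B CB <-]|].
      by have [AB|BA] := Ctot _ _ CA CB; [left|right]; apply: setUSS; apply: image_subset.
    by move=> _ [A /Cok[_ _ gA] <-].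
- have AeF : entries alpha A ≼ F.
    by apply: setU_embeds; apply: embeds_trans (embeds_image _ _) AF.
  have [||e [eOK ec eb] ge] := ext (G0 `|` entries alpha A) _ (setU_embeds G0F AeF).
  - exact: subsetUl.
  - exact: gA.
  have before_e e' : A e' -> before alpha e' e.
    move=> Ae'; split.
      have := ec (inst alpha e'.1.1); rewrite sat_inst; apply.
      by right; left; exists e'.
    have := eb (inst_leaf e'.2 e'.1.2); rewrite sat_inst_leaf; apply.
    by right; right; exists e'.
  exists e.
    by move=> Ae; have [/(dis _ _ eOK)] := before_e e Ae.
  split; last by rewrite entriesU setUA.
  - by move=> e' [/AOK|->].
  - move=> e1 e2 [A1|->] [A2|->]; first exact: Abef.
    + by apply: Or32; apply: before_e.
    + by apply: Or33; apply: before_e.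
    + exact: Or31.
have [beta binf] := infinite_fibre nAF.
exists beta.
  by have [e [/AOK + <-]] := infinite_setN0 binf.
move=> N; have [|f fA fbef] := infinite_chain N.+1 (r := before alpha) binf.
  move=> e e' [Ae _] [Ae' _].
  by have [->|?|?] := Abef _ _ Ae Ae'; [left|right; left|right; right].
exists (fun i => (f i).1.2), (fun i => (f i).1.1) => i j iN jN.
split=> ij; first by have [] := fbef _ _ ij (ltnW iN).
by have [_] := fbef _ _ ij (ltnW jN); have [_ ->] := fA i.
Qed.

(** By saturation, finite orders of all lengths suffice, provided that they use
   the same negation. *)
Lemma order_property_of_finite chi : negation T phi chi ->
  (forall N, exists (a : nat -> 'I_m -> M) (b : nat -> 'I_n -> M),
    forall i j, i < N -> j < N -> (i < j -> sat phi (join (a i) (b j))) /\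
                                  (j <= i -> sat chi (join (a i) (b j)))) ->
  order_property T M phi.
Proof.
move=> nchi fin.
pose var (i j : nat) (z : 'I_m + 'I_n) : (nat * 'I_m + nat * 'I_n) + M :=
  match z with inl x => inl (inl (i, x)) | inr y => inl (inr (j, y)) end.
pose f (z : nat * nat) := rename (var z.1 z.2) (if z.1 < z.2 then phi else chi).
have [|||v vP] := saturate_small mon (f := f).
- apply: (small_form mon); apply: embeds_trans (formD_embeds L).
  by apply: embeds_sum; apply: prod_embeds (nat_embeds_form L) (ord_embeds L _).
- by apply: (small_form mon); apply: prod_embeds; apply: nat_embeds_form.
- move=> s; pose N := (\max_(z <- s) maxn z.1 z.2).+1.
  have [a [b abP]] := fin N.
  exists (fun z => match z with inl (i, x) => a i x | inr (j, y) => b j y end).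
  move=> [i j] ijs; have {ijs} : maxn i j < N.
    rewrite /N ltnS; elim: s {N abP} ijs => //= z s IHs [->|zs];
      rewrite big_cons leq_max ?leqnn //.
    by rewrite IHs ?orbT.
  rewrite gtn_max => /andP[iN jN]; have [ab1 ab2] := abP i j iN jN.
  rewrite /f sat_rename.
  have -> : join (fun z => match z with inl (i, x) => a i x | inr (j, y) => b j y end) id
      \o var i j = join (a i) (b j) by apply: funext => -[].
  by case: (ltnP i j).
exists (fun i x => v (inl (i, x))), (fun j y => v (inr (j, y))), chi; split=> // i j.
have := vP (i, j); rewrite /f sat_rename /=.
have -> : join v id \o var i j = join (fun x => v (inl (i, x))) (fun y => v (inr (j, y))).
  by apply: funext => -[].
by case: (ltnP i j).
Qed.

(** Call a good set stuck if none of its leaves [c] can be related by [phi] to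
   all nodes. If no good set is stuck, each step imposes [phi(c, y)] for such a
   leaf [c] and then [psi(x, b)] for a splitting node [b]. Above a stuck set all
   good sets are stuck: a step imposes [phi(x, b)] and, by [good_colour], some
   negation of [phi] between [c] and the later nodes. *)
Lemma tree_order_property :
  (forall k, has_tree phi psi [set: 'I_m -> M] [set: 'I_n -> M] k) ->
  order_property T M phi.
Proof.
move=> trees.
have g0 : good phi psi (@set0 (constraint M m n)).
  move=> [|c s] s0 k; last by case: (s0 c (or_introl erefl)).
  apply: has_treeW (trees k) => // a _.
have F0 : @set0 (constraint M m n) ≼ F by exists (fun=> Top) => -[x xs]; have := set_mem xs.
pose stuck G := forall c, leaf_of G c -> ~ good phi psi (G `|` [set inr (inst_leaf phi c)]).
have [[G0 [G0F gG0 G0s]]|nstuck] :=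
    pselect (exists G, [/\ G ≼ F, good phi psi G & stuck G]).
  have [||beta nbeta ladder] := @uniform_ladder phi [set chi | negation T phi chi] G0 G0F gG0.
  - by move=> beta v nbeta; apply: (negation_disjoint mon nbeta).
  - move=> G G0G GF gG; have [b [Gb gl _]] := good_split mon GF gG.
    have [c Gc] := good_leaf mon GF gG.
    have [|chi cchi gchi] := good_colour mon c _ gl.
      by apply: setU_embeds => //; apply: set1_embeds.
    exists (b, c, chi); last first.
      by rewrite /entries !image_set1 setUA.
    split=> //=; case: cchi gchi => // -> gphi; exfalso; apply: (G0s c).
      by move=> theta /G0G; apply: Gc.
    apply: goodS gphi; apply: setSU => d /G0G; by left.
  apply: (order_property_of_finite nbeta) => N.
  (* The order is reversed. Doubling the indices takes leaves and nodes from
     different entries, as a ladder relates distinct entries only. *)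
  have [c [b cbP]] := ladder (2 * N).+2.
  exists (fun i => c (2 * (N - i))), (fun j => b (2 * (N - j)).+1) => i j iN jN.
  have [||P1 P2] := cbP (2 * (N - i)) (2 * (N - j)).+1; [lia|lia|].
  by split=> ij; [apply: P1; lia|apply: P2; lia].
have [||beta bphi ladder] := @uniform_ladder psi [set phi] _ F0 g0.
- by move=> beta v -> psiv phiv; apply: (negation_disjoint mon neg_psi) phiv psiv.
- move=> G _ GF gG.
  have [c [Gc gc]] : exists c, leaf_of G c /\ good phi psi (G `|` [set inr (inst_leaf phi c)]).
    apply: contrapT => /forallNP nc; apply: nstuck; exists G; split=> // c Gc gc.
    exact: (nc c).
  have [|b [Gb _ gr]] := good_split mon _ gc.
    by apply: setU_embeds => //; apply: set1_embeds.
  exists (b, c, phi); first split=> //.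
    by move=> kappa Gk; apply: Gb; left.
  by rewrite /entries !image_set1 setUA setUAC.
rewrite bphi in ladder.
apply: (order_property_of_finite neg_psi) => N.
have [c [b cbP]] := ladder (2 * N).+2.
exists (fun i => c (2 * i).+1), (fun j => b (2 * j)) => i j iN jN.
have [||P1 P2] := cbP (2 * i).+1 (2 * j); [lia|lia|].
by split=> ij; [apply: P2; lia|apply: P1; lia].
Qed.

End Ladders.

(** * Rank and height *)

Section Ordinals.

Lemma ord_le_refl a : ord_le a a.
Proof. by elim: a => I f IH /= i; exists i. Qed.

Lemma ord_succ_nle a : ~ ord_le (ord_succ a) a.
Proof.
elim: a => I f IH /= /(_ tt)[j aj].
apply: (IH j); apply: (@ord_le_trans _ (Sup f)) aj => /= _; exists j.
exact: ord_le_refl.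
Qed.

Definition ord_nat k := iter k ord_succ ord_zero.

Lemma ord_nat_le i j : i <= j -> ord_le (ord_nat i) (ord_nat j).
Proof.
elim: i j => [|i IHi] [|j] //= ij.
by move=> _; exists tt; apply: IHi.
Qed.

Lemma ord_nat_lt_omega k : ord_le (ord_nat k.+1) ord_omega.
Proof. by move=> /= _; exists k; apply: ord_le_refl. Qed.

Lemma ord_omega_limit : ord_limit ord_omega.
Proof.
split=> [|a [j aj]]; first by exists 0; apply: ord_le_refl.
by exists j.+1 => /= _; exists tt.
Qed.

End Ordinals.

Section Rank.
Variables (L : signature) (M : structure L) (m n : nat).
Variables (phi psi : form L ('I_m + 'I_n)).
Implicit Types (S : set (form L ('I_m + M))).

Definition solutions S : set ('I_m -> M) :=
  [set a | forall chi, S chi -> sat chi (join a id)].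

Local Notation tree S k := (has_tree phi psi (solutions S) setT k).

Lemma solutions_inst S chi (b : 'I_n -> M) :
  solutions (S `|` [set inst chi b]) = solutions S `&` fibre chi b.
Proof.
apply/seteqP; split=> a.
  move=> aS; split=> [theta St|]; first by apply: aS; left.
  by have := aS _ (or_intror erefl); rewrite sat_inst.
by move=> [aS ab] theta [/aS//|->]; rewrite sat_inst.
Qed.

Lemma tree_rank_ge S k : tree S k ->
  xord_le (XOrd (ord_nat k)) (rank phi psi S).
Proof.
have [[R1 R2 _] _] := rankP M phi psi.
elim: k S => [|k IHk] S /=; first exact: R1.
move=> [b [_ tl tr]]; apply: R2; exists b.
by split; apply: IHk; rewrite solutions_inst.
Qed.

Lemma tree_rank_omega S : (forall k, tree S k) ->
  xord_le (XOrd ord_omega) (rank phi psi S).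
Proof.
move=> trees; have [[_ _ R3] _] := rankP M phi psi.
apply: R3 ord_omega_limit _ => a [j aj].
by apply: xord_le_trans (tree_rank_ge (trees j)).
Qed.

(** The rank of a set for which [k] is the least height without a tree. *)
Definition height_rank k := if k is k'.+1 then XOrd (ord_nat k') else XNeg1.

(** The rank is at most the height of the trees, since the latter satisfies the
   clauses defining the rank. *)
Lemma rank_le_height S k : ~ tree S k -> exists j, xord_le (rank phi psi S) (height_rank j).
Proof.
move=> ntree; pose spec S v := ((forall k, tree S k) /\ v = XInf) \/
  exists k, [/\ ~ tree S k, forall j, j < k -> tree S j & v = height_rank k].
have /choice[R RP] S' : exists v, spec S' v.
  have [all|/existsNP ex] := pselect (forall k, tree S' k); first by exists XInf; left.
  have ex' : exists k, `[< ~ tree S' k >] by case: ex => j nj; exists j; apply/asboolP.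
  case: (ex_minnP ex') => j /asboolP nj jmin; exists (height_rank j); right; exists j.
  split=> // i ij; apply: contrapT => ni.
  by have := jmin i; rewrite leqNgt ij => /(_ (introT (asboolP _) ni)).
have upper S' j a : ~ tree S' j -> xord_le (XOrd a) (R S') ->
    exists2 i, i < j & ord_le a (ord_nat i).
  move=> nt; have [[/(_ j)//]|[i [ni imin ->]]] := RP S'.
  case: i ni imin => // i ni imin ai; exists i => //.
  by rewrite ltnNge; apply/negP => /imin.
have cR : rank_closed phi psi R.
  split=> [S' [a aS']|S' a [b [al ar]]|S' l [l0 lS] la].
  - have [[_ ->//]|[[|j] [nj _ ->]]] := RP S'; last exact: ord_nat_le (leq0n j).
    by case: nj; exists a.
  - have [[_ ->//]|[[|j] [nj _ ->]]] := RP S'.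
      have [|//] := upper _ 0 _ _ al.
      by apply: contra_not nj; rewrite solutions_inst => -[c [? _]]; exists c.
    have [i ij ai] : exists2 i, i < j & ord_le a (ord_nat i).
      have [tl|nl] := pselect (tree (S' `|` [set inst phi b]) j); last exact: upper nl al.
      apply: upper ar => tr; apply: nj; exists b.
      by rewrite -!solutions_inst.
    apply: (@ord_le_trans _ (ord_nat i.+1)); last exact: ord_nat_le.
    by move=> _; exists tt.
  - have [[_ ->//]|[[|j] [nj _ e]]] := RP S'.
      by have := la _ l0; rewrite e.
    rewrite e; apply: contrapT => /ord_nle_lt /lS /la; rewrite e.
    exact: ord_succ_nle.
have [[/(_ k)//]|[j [_ _ e]]] := RP S.
by exists j; rewrite -e; have [_] := rankP M phi psi; apply.
Qed.

Lemma rank_lt_omega S :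
  xord_lt (rank phi psi S) (XOrd ord_omega) <-> exists k, ~ tree S k.
Proof.
split=> [[_ nle]|[k /rank_le_height[j]]].
  by apply: contrapT => /forallNP all; apply/nle/tree_rank_omega => k; apply: contrapT.
case: (rank phi psi S) => [|a|]; case: j => [|j] //= aj; split=> //.
  apply: ord_le_trans aj (ord_le_trans (ord_nat_le (leqnSn j)) _).
  exact: ord_nat_lt_omega.
move=> oa; apply: (@ord_succ_nle (ord_nat j)).
exact: ord_le_trans (ord_nat_lt_omega j) (ord_le_trans oa aj).
Qed.

Lemma solutions_eqxx : solutions [set @var_eqxx L m M] = setT.
Proof.
apply/seteqP; split=> // a _ _ ->; rewrite /var_eqxx.
by apply: (big_ind (fun p : form L ('I_m + M) => sat p (join a id))).
Qed.

End Rank.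

(** * Tall trees *)

Section TallTrees.
Variables (L : signature) (T : theory L) (K : Type) (M : structure L).
Hypothesis mon : monster T K M.
Variables (m n : nat) (phi psi : form L ('I_m + 'I_n)).
Local Notation F := (form L nat).

Lemma sorted_filter_take (W : eqType) (lt : rel W) (ws : seq W) w :
  irreflexive lt -> transitive lt -> sorted lt ws -> w \in ws ->
  [seq v <- ws | lt v w] = take (index w ws) ws.
Proof.
move=> irr tr; elim: ws => //= x s IHs xs.
have /allP xlt := order_path_min tr xs.
rewrite inE eq_sym; case: eqVneq => [<-|_] /= ws; last first.
  by rewrite xlt // IHs // (path_sorted xs).
rewrite irr -(filter_pred0 s); apply: eq_in_filter => y /xlt xy.
by apply/negP => /(tr _ _ _ xy); rewrite irr.
Qed.

Lemma exists_sorted (W : eqType) (lt : rel W) (s : seq W) : transitive lt ->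
  (forall x y, [|| x == y, lt x y | lt y x]) ->
  exists2 ws, sorted lt ws & ws =i s.
Proof.
move=> tr tot; pose le x y := (x == y) || lt x y.
have le_total : total le.
  by move=> x y; rewrite /le (eq_sym y); case/or3P: (tot x y) => ->; rewrite ?orbT.
exists (sort le (undup s)); last by move=> x; rewrite mem_sort mem_undup.
have : uniq (sort le (undup s)) by rewrite sort_uniq undup_uniq.
have := sort_sorted le_total (undup s); case: (sort le _) => //= x r.
elim: r x => //= y r IHr x /andP[/predU1P[->|xy] yr] /andP[].
  by rewrite inE eqxx.
by move=> _ /(IHr _ yr) ->; rewrite xy.
Qed.

(** By saturation, trees of all finite heights give a tree the levels of which
   are indexed by any small linear order [W]: [b w f] is the node of level [w]
   above which the branch is [f], and [a s] is a leaf on the branch [s]. *)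
Lemma tall_tree (X : Type) (W : eqType) (lt : rel W) :
  nat ≼ X -> small K [set: X] -> W ≼ X -> irreflexive lt -> transitive lt ->
  (forall x y, [|| x == y, lt x y | lt y x]) ->
  (forall k, has_tree phi psi [set: 'I_m -> M] setT k) ->
  exists (b : W -> (W -> bool) -> 'I_n -> M) (a : (W -> bool) -> 'I_m -> M),
    forall s w, sat (if s w then psi else phi) (join (a s) (b w (cutoff lt s w))).
Proof.
move=> natX Xs WX irr tr tot trees.
pose P := set X; have Ps : small K [set: P] := monster_strong_limit mon Xs.
have XP : X ≼ P.
  exists (fun x => [set x]) => x y /(congr1 (@^~ x)) /= xy.
  by have -> : x = y by rewrite -xy.
have natP : nat ≼ P := embeds_trans natX XP.
have PP Y Z : Y ≼ P -> Z ≼ P -> Y * Z ≼ P.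
  by move=> YP ZP; apply: embeds_trans (embeds_prod YP ZP) (embeds_square natP).
have WP : W ≼ P := embeds_trans WX XP.
have BP : (W -> bool) ≼ P.
  have [f fI] := WX; exists (fun s => [set f w | w in [set w | s w]]) => s t.
  have half s' t' : [set f w | w in [set w | s' w]] = [set f w | w in [set w | t' w]] ->
      forall w, s' w -> t' w.
    move=> e w sw; have : [set f w | w in [set w | t' w]] (f w) by rewrite -e; exists w.
    by move=> [w' tw' /fI <-].
  move=> st; apply: funext => w; apply/idP/idP.
    exact: (half _ _ st).
  exact: (half _ _ (esym st)).
have ordP k : 'I_k ≼ P by apply: embeds_trans natP; exists val; apply: val_inj.
pose V := (W * (W -> bool) * 'I_n + (W -> bool) * 'I_m)%type.
pose var (s : W -> bool) w (z : 'I_m + 'I_n) : V + M :=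
  match z with inl x => inl (inr (s, x)) | inr y => inl (inl (w, cutoff lt s w, y)) end.
pose f (z : (W -> bool) * W) :=
  rename (var z.1 z.2) (if z.1 z.2 then psi else phi).
have [|||v vP] := saturate_small mon (f := f).
- apply: small_embeds Ps _; apply: (embeds_sum_infinite natP).
    by apply: (PP _ _) => //; apply: (PP _ _).
  by apply: (PP _ _).
- by apply: small_embeds Ps _; apply: PP.
- move=> l; have [ws ws_sorted wsE] := @exists_sorted W lt (map snd l) tr tot.
  have [b [a baP]] := has_tree_unfold (trees (size ws)).
  (* Only the finitely many levels [ws] occur, and the nodes of a tree of height
     [size ws] are spread over them. *)
  exists (fun z => match z with
    | inl (w, g, y) => b (map g [seq v <- ws | lt v w]) y
    | inr (s, x) => a (map s ws) x end) => -[s w] swl.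
  have {swl} wws : w \in ws.
    rewrite wsE; elim: l swl {wsE} => //= z l IHl [->|/IHl]; rewrite inE /= ?eqxx //.
    by move=> ->; rewrite orbT.
  have [_ /(_ (index w ws))] := baP (map s ws) (size_map _ _).
  rewrite index_mem => /(_ wws); rewrite (nth_map w) ?index_mem // nth_index //.
  rewrite /f sat_rename -map_take -(sorted_filter_take irr tr ws_sorted wws) /=.
  have -> : [seq s v | v <- ws & lt v w] = [seq cutoff lt s w v | v <- ws & lt v w].
    by apply/eq_in_map => v; rewrite mem_filter /cutoff => /andP[->].
  by congr (sat _ _); apply: funext => -[].
exists (fun w g y => v (inl (w, g, y))), (fun s x => v (inr (s, x))) => s w.
by have := vP (s, w); rewrite /f sat_rename; congr (sat _ _); apply: funext => -[].
Qed.

Lemma binary_tree_of_trees : negation T phi psi ->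
  (forall k, has_tree phi psi [set: 'I_m -> M] setT k) ->
  binary_tree_property T M phi.
Proof.
move=> npsi trees.
have nats : small K [set: nat] by apply: (small_form mon); apply: nat_embeds_form.
have tot (x y : nat) : [|| x == y, ltn x y | ltn y x] by rewrite /=; case: (ltngtP x y).
have [b [a abP]] := tall_tree (embeds_refl nat) nats (embeds_refl nat) ltnn ltn_trans tot trees.
exists psi, (fun s => b (size s) (nth false s)); split=> // s.
exists (a s) => _ [k _ <-]; rewrite sat_inst size_mkseq.
have -> : nth false (mkseq s k) = cutoff ltn s k; last exact: abP.
apply: funext => i; rewrite /cutoff /=; case: ltnP => ik; first by rewrite nth_mkseq.
by rewrite nth_default // size_mkseq.
Qed.

(** The tree above the node [s] is found by induction on the height, with leaves
   among the elements following the branch up to [s]. *)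
Lemma trees_of_binary_tree (b : seq bool -> 'I_n -> M) :
  (forall s : nat -> bool, consistent
    [set inst (if s k then psi else phi) (b (mkseq s k)) | k in [set: nat]]) ->
  forall k, has_tree phi psi [set: 'I_m -> M] setT k.
Proof.
move=> bP; pose P s : set ('I_m -> M) := [set a | forall i, i < size s ->
  sat (if nth false s i then psi else phi) (join a (b (take i s)))].
suff tree k s : has_tree phi psi (P s) setT k by move=> k; apply: has_treeW (tree k [::]).
elim: k s => [|k IHk] s /=.
  have [a aP] := bP (nth false s); exists a => i si.
  have := aP _ (ex_intro2 _ _ i I erefl); rewrite sat_inst.
  by rewrite -[in take _ s](mkseq_nth false s) /mkseq -map_take take_iota (minn_idPl (ltnW si)).
have sub x : P (rcons s x) `<=` P s `&` fibre (if x then psi else phi) (b s).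
  move=> a aP; split=> [i si|].
    have := aP i; rewrite size_rcons nth_rcons si -cats1 takel_cat ?(ltnW si) //.
    by apply; apply: ltnW.
  by have := aP (size s); rewrite size_rcons nth_rcons ltnn eqxx -cats1 take_size_cat //; apply.
exists (b s); split=> //.
  by apply: has_treeW (IHk (rcons s false)) => //; apply: (sub false).
by apply: has_treeW (IHk (rcons s true)) => //; apply: (sub true).
Qed.

(** Bisection: [b] with index [l + 2 ^ k] separates the elements with indices
   from [l] to [l + 2 ^ (k + 1)] into two halves. *)
Lemma trees_of_order (a : nat -> 'I_m -> M) (b : nat -> 'I_n -> M) :
  (forall i j, (i < j -> sat phi (join (a i) (b j))) /\
               (j <= i -> sat psi (join (a i) (b j)))) ->
  forall k, has_tree phi psi [set: 'I_m -> M] setT k.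
Proof.
move=> abP; suff tree k l P : (forall i, l <= i < l + 2 ^ k -> P (a i)) ->
    has_tree phi psi P setT k by move=> k; apply: (tree k 0).
elim: k l P => [|k IHk] l P lP /=; first by exists (a l); apply: lP; lia.
exists (b (l + 2 ^ k)); split=> //.
  apply: (IHk l) => i il; split; first by apply: lP; rewrite expnS; lia.
  by apply: (abP _ _).1; lia.
apply: (IHk (l + 2 ^ k)) => i il; split; first by apply: lP; rewrite expnS; lia.
by apply: (abP _ _).2; lia.
Qed.

(** A tree with at most [Lam] nodes and more than [Lam] branches contradicts
   stability, as two branches are told apart by the node at which they part. *)
Lemma stable_no_tree : negation T phi psi -> stable M K phi ->
  exists k, ~ has_tree phi psi [set: 'I_m -> M] setT k.
Proof.
move=> npsi [Lam [/infiniteP/card_leTE natLam Lams Lstable]].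
apply: contrapT => /forallNP trees.
have [W [lt [[irr tr tot wf] WLam nW nodesLam]]] := exists_wide_tree natLam.
have [|b [a abP]] := tall_tree natLam Lams WLam irr tr tot.
  by move=> k; apply: contrapT; apply: trees.
pose N := [set (w, cutoff lt s w) | w in setT & s in setT].
pose B : set M := [set b z.1.1 z.1.2 z.2 | z in [set z | N z.1]].
have BLam : B #<= [set: Lam].
  apply/card_leTr; apply: embeds_trans (embeds_image _ _) _.
  apply: embeds_trans (embeds_square natLam).
  have natI : 'I_n ≼ Lam by apply: embeds_trans natLam; exists val; apply: val_inj.
  apply: embeds_trans (embeds_prod nodesLam natI).
  have zN (z : [set z : W * (W -> bool) * 'I_n | N z.1]) : N (val z).1 := set_valP z.
  exists (fun z => (SigSub (mem_set (zN z)), (val z).2)) => z z' [].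
  move=> e1 e2; apply: val_inj => /=.
  by rewrite [val z]surjective_pairing [val z']surjective_pairing /= e1 e2.
have inB s w y : B (b w (cutoff lt s w) y).
  by exists (w, cutoff lt s w, y) => //=; exists w => //; exists s.
pose bB s w : 'I_n -> B := fun y => SigSub (mem_set (inB s w y)).
have bBE s w : val \o bB s w = b w (cutoff lt s w) by apply: funext.
have inst_tp c s w : tp_phi phi c B (inst phi (bB s w)) <->
    sat phi (join c (b w (cutoff lt s w))).
  split=> [[d dc e]|cb]; last by exists (bB s w); rewrite //= bBE.
  by rewrite -bBE -sat_inst -e sat_inst.
apply: nW; apply: embeds_trans ((card_leTr _ _).1 (Lstable B BLam)).
have inS s : S_phi phi B (tp_phi phi (a s) B) by exists (a s).
exists (fun s => SigSub (mem_set (inS s))) => s t /(congr1 val) /= st.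
apply: contrapT => nst.
have [|w /= stw wmin] := wf [set w | s w != t w].
  apply: contrapT => /forallNP e; apply: nst; apply: funext => w.
  by apply/eqP/negPn/negP; apply: e.
have est : cutoff lt s w = cutoff lt t w.
  apply: funext => v; rewrite /cutoff; case vw : (lt v w) => //=.
  by apply: contrapT => /eqP /wmin; rewrite vw.
have := inst_tp (a s) s w; rewrite st (inst_tp (a t) s w) est.
have := abP t w; have := abP s w; rewrite est.
case: (s w) (t w) stw => -[] //= _ h1 h2 [e1 e2].
  exact: (negation_disjoint mon npsi (e1 h2) h1).
exact: (negation_disjoint mon npsi (e2 h1) h2).
Qed.

End TallTrees.

(** * Definability and counting *)

Section Definability.
Variables (L : signature) (T : theory L) (K : Type) (M : structure L).
Hypothesis mon : monster T K M.
Variables (m n : nat) (phi : form L ('I_m + 'I_n)).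
Local Notation F := (form L nat).

(** The formula [theta] of [tp a B] is chosen to have no tree of height [k + 1]
   with [k] least. The formula [chi] says that [theta(x)] and [phi(x, y)] have a
   tree of height [k], as they do for [phi(x, b)] in the type by the choice of
   [k]. If [psi(x, b)] is in the type, [theta(x)] and [psi(x, b)] have a tree of
   height [k] too, and both together would be a tree of height [k + 1]. *)
Lemma local_definition psi (B : set M) (a : 'I_m -> M) :
  (exists k, ~ has_tree phi psi [set: 'I_m -> M] setT k) ->
  exists chi : form L ('I_n + B),
    (forall b : 'I_n -> B, sat phi (join a (val \o b)) ->
      sat chi (join (val \o b) val)) /\
    (forall b : 'I_n -> B, sat psi (join a (val \o b)) ->
      ~ sat chi (join (val \o b) val)).
Proof.
move=> [k0 nk0].
pose sol (theta : form L ('I_m + B)) : set ('I_m -> M) :=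
  [set c | sat theta (join c val)].
pose bad k := `[< exists2 theta, tp a B theta & ~ has_tree phi psi (sol theta) setT k >].
have exbad : exists k, bad k.
  exists k0; apply/asboolP; exists Top; first by [].
  by move=> t; apply: nk0; apply: has_treeW (leqnn k0) t.
case: (ex_minnP exbad) => -[|k] /asboolP[theta tha nk] kmin.
  by case: nk; exists a.
have tree theta' : tp a B theta' -> has_tree phi psi (sol theta') setT k.
  move=> tha'; apply: contrapT => nk'; suff : k < k by rewrite ltnn.
  by apply: kmin; apply/asboolP; exists theta'.
have solI chi (b : 'I_n -> B) : sol (And theta (inst chi b)) =
    sol theta `&` fibre chi (val \o b).
  by apply/seteqP; split=> c; rewrite /sol /= sat_inst.
have tpI chi (b : 'I_n -> B) : sat chi (join a (val \o b)) ->
    tp a B (And theta (inst chi b)).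
  by move=> ab; split=> //; rewrite sat_inst.
exists (tree_form phi psi (And (skip_mid 'I_n theta) (skip_last B phi)) Top k).
have chiE (b : 'I_n -> M) :
    sat (tree_form phi psi (And (skip_mid 'I_n theta) (skip_last B phi)) Top k)
      (join b val) <-> has_tree phi psi (sol theta `&` fibre phi b) setT k.
  rewrite sat_tree_form.
  have -> : [set c | sat (And (skip_mid 'I_n theta) (skip_last B phi)) (join c (join b val))]
      = sol theta `&` fibre phi b.
    by apply: funext => c /=; rewrite sat_skip_mid sat_skip_last.
  exact: iff_refl.
split=> b ab; rewrite chiE.
  by rewrite -solI; apply: tree; apply: tpI.
move=> tl; apply: nk; exists (val \o b); split=> //.
by rewrite -solI; apply: tree; apply: tpI.
Qed.

(** The local definitions for all negations together suffice, because
   [phi(x, b)] fails only if some negation holds. *)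
Lemma definable_of_no_tree :
  (forall psi, negation T phi psi ->
    exists k, ~ has_tree phi psi [set: 'I_m -> M] setT k) ->
  forall (B : set M) (p : set (form L ('I_m + B))), is_type p -> phi_definable phi p.
Proof.
move=> ntrees B p [a ->].
have /choice[g gP] psi : exists chi : form L ('I_n + B), negation T phi psi ->
    (forall b : 'I_n -> B, sat phi (join a (val \o b)) ->
      sat chi (join (val \o b) val)) /\
    (forall b : 'I_n -> B, sat psi (join a (val \o b)) ->
      ~ sat chi (join (val \o b) val)).
  have [npsi|] := pselect (negation T phi psi); last by exists Top.
  by have [chi chiP] := @local_definition psi B a (ntrees _ npsi); exists chi.
exists (g @` [set psi | negation T phi psi]); split.
  apply/card_leTr; apply: embeds_trans (embeds_image _ _) _.
  exact: embeds_trans (embeds_set _) (form_ord_embeds _ _ _).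
move=> b; rewrite /tp /= sat_inst; split=> [ab _ [psi npsi <-]|abd].
  by have [+ _] := gP psi npsi; apply.
apply: contrapT => /(ec_negation mon)[psi npsi ab].
have [_ /(_ b ab)] := gP psi npsi; apply; apply: abd; by exists psi.
Qed.

(** Finitely many assignments of the variables become one after renaming the
   variables apart, by pairing each with the index of its assignment. *)
Lemma merge_assignments (V : Type) (v0 : V) (k : nat) (g : 'I_k -> nat -> V) :
  exists h : nat -> V, forall i (j : nat), h (pickle (i, j)) = g i j.
Proof.
exists (fun l => oapp (fun z : 'I_k * nat => g z.1 z.2) v0 (unpickle l)).
by move=> i j; rewrite pickleK.
Qed.

Lemma eval_code (V : Type) (v0 : V) k (ts : 'I_k -> term L V) :
  exists (us : 'I_k -> term L nat) (g : nat -> V),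
    forall (v : V -> M) i, eval v (ts i) = eval (v \o g) (us i).
Proof.
pose code (t : term L V) (u : term L nat * (nat -> V)) :=
  forall v : V -> M, eval v t = eval (v \o u.2) u.1.
have merge r (ts' : 'I_r -> term L V) : (forall i, exists u, code (ts' i) u) ->
    exists (us : 'I_r -> term L nat) (g : nat -> V),
      forall (v : V -> M) i, eval v (ts' i) = eval (v \o g) (us i).
  move=> /choice[u uP]; have [g gE] := merge_assignments v0 (fun i => (u i).2).
  exists (fun i => trename (fun j => pickle (i, j)) (u i).1), g => v i.
  by rewrite uP eval_rename; congr eval; apply: funext => j /=; rewrite gE.
have codeP t : exists u, code t u; last exact: merge (fun i => codeP (ts i)).
elim: t => [x|f us /merge[ws [g gP]]]; first by exists (Var L 0, fun=> x).
by exists (App ws, g) => v /=; congr finterp; apply: funext.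
Qed.

Lemma sat_code_inhabited (V : Type) (p : form L V) : V ->
  exists z : F * (nat -> V), forall v : V -> M, sat p v = sat z.1 (v \o z.2).
Proof.
have merge (V' : Type) (v0 : V') (z1 z2 : F * (nat -> V')) :
    exists (p1 p2 : F) (g : nat -> V'), forall v : V' -> M,
      sat z1.1 (v \o z1.2) = sat p1 (v \o g) /\ sat z2.1 (v \o z2.2) = sat p2 (v \o g).
  have [g gE] := merge_assignments v0 (fun i : 'I_2 => if i == ord0 then z1.2 else z2.2).
  exists (rename (fun j => pickle (ord0 : 'I_2, j)) z1.1).
  exists (rename (fun j => pickle (ord_max : 'I_2, j)) z2.1), g => v.
  by rewrite !sat_rename; split; congr sat; apply: funext => j /=; rewrite gE.
elim: p => {V}
  [V|V|V s t|V r ts|V q IHq r IHr|V q IHq r IHr|V q IHq] v0.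
- by exists (Top, fun=> v0).
- by exists (Bot, fun=> v0).
- have [us [g gP]] := eval_code v0 (fun i : 'I_2 => if i == ord0 then s else t).
  exists (Eq (us ord0) (us ord_max), g) => v /=.
  by rewrite -(gP v ord0) -(gP v ord_max).
- have [us [g gP]] := eval_code v0 ts.
  by exists (Rel us, g) => v /=; congr (rinterp _); apply/funext => i; apply: gP.
- have [[zq zqP] [zr zrP]] := (IHq v0, IHr v0).
  have [p1 [p2 [g gP]]] := merge _ v0 zq zr.
  by exists (And p1 p2, g) => v /=; have [<- <-] := gP v; rewrite zqP zrP.
- have [[zq zqP] [zr zrP]] := (IHq v0, IHr v0).
  have [p1 [p2 [g gP]]] := merge _ v0 zq zr.
  by exists (Or p1 p2, g) => v /=; have [<- <-] := gP v; rewrite zqP zrP.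
(* A variable sent to the bound variable is itself replaced by it. *)
- have [[p1 g] gP] := IHq None.
  exists (Ex (rename (fun j => omap (fun=> j) (g j)) p1), fun j => odflt v0 (g j)).
  move=> v /=; apply: eq_exists => c; rewrite gP sat_rename; congr sat.
  by apply: funext => j /=; case gj : (g j) => [x|] /=; rewrite ?gj.
Qed.

(** A formula over parameters is a formula of the language together with an
   assignment of its variables; [x0] takes care of an empty set of variables. *)
Lemma sat_code (V : Type) (p : form L V) (x0 : M) :
  exists z : F * (nat -> option V), forall v : V -> M,
    sat p v = sat z.1 (oapp v x0 \o z.2).
Proof.
have [z zP] := sat_code_inhabited (rename Some p) None.
by exists z => v /=; rewrite -zP sat_rename.
Qed.

Lemma embeds_curry X Y Z W : X * Y -> X * Y ≼ Z -> (X -> Y -> W) ≼ (Z -> W).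
Proof.
move=> p0 [h hI]; have /choice[g gK] z : exists p, forall q, h q = z -> q = p.
  have [[p <-]|nz] := pselect (exists p, h p = z); first by exists p => q /hI.
  by exists p0 => q qz; case: nz; exists q.
exists (fun f z => f (g z).1 (g z).2) => f f' ff'.
apply: funext => x; apply: funext => y.
by have := congr1 (@^~ (h (x, y))) ff'; rewrite -(gK (h (x, y)) (x, y) erefl).
Qed.

(** A definition of a type over [B] is coded by [|T|] formulas with their
   parameters, and the [phi]-type is determined by its definition. *)
Lemma count_of_definable (B : set M) :
  (forall p : set (form L ('I_m + B)), is_type p -> phi_definable phi p) ->
  S_phi phi B ≼ (F -> B + F).
Proof.
move=> def; have [x0] := carrier_inhabited M.
pose V := ('I_n + B)%type; pose Y := (B + F)%type.
have VY : option V ≼ Y.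
  exists (fun v : option V => match v return Y with None => inr Bot
    | Some (inl i) => inr (var_eq L i) | Some (inr b) => inl b end).
  by move=> [[i|b]|] [[j|c]|] // [] => [/val_inj|] ->.
have codeY : F * (nat -> option V) ≼ (nat -> Y).
  apply: embeds_trans (embeds_prod (embeds_refl _) (embeds_funr _ VY)) _.
  exists (fun z k => if k is k'.+1 then z.2 k' else inr z.1).
  move=> [p g] [q h] /= pq; have := congr1 (@^~ 0) pq => /= -[->]; congr pair.
  by apply: funext => k; apply: (congr1 (@^~ k.+1) pq).
have codesY : (F -> F * (nat -> option V)) ≼ (F -> Y).
  apply: embeds_trans (embeds_funr _ codeY) _.
  apply: embeds_curry; first exact: (Top, 0).
  exact: prod_embeds (embeds_refl _) (nat_embeds_form L).
apply: embeds_trans codesY.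
have /choice[e eP] (t : S_phi phi B) : exists e : F -> F * (nat -> option V),
    val t = inst phi @` [set b : 'I_n -> B | forall f,
      sat (e f).1 (oapp (join (val \o b) val) x0 \o (e f).2)].
  have [a _ ta] := set_valP t.
  have [|d [dF dP]] := def (tp a B); first by exists a.
  have [h hP] : exists h : F -> form L V, forall b : 'I_n -> B,
      (forall chi, d chi -> sat chi (join (val \o b) val)) <->
      (forall f, sat (h f) (join (val \o b) val)).
    have [k kI] := (card_leTr _ _).1 dF.
    have /choice[h hP] f : exists chi : form L V, (d chi \/ chi = Top) /\
        forall c : d, k c = f -> chi = val c.
      have [[c <-]|nf] := pselect (exists c, k c = f).
        by exists (val c); split=> [|c' /kI -> //]; left; apply: set_valP.
      by exists Top; split=> [|c cf]; [right|case: nf; exists c].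
    exists h => b; split=> [db f|hb chi dchi].
      by have [[dh|->] _] := hP f; first exact: db.
    have [_ /(_ (SigSub (mem_set dchi)) erefl) hchi] := hP (k (SigSub (mem_set dchi))).
    by have := hb (k (SigSub (mem_set dchi))); rewrite hchi.
  have /choice[e eP] f := sat_code (h f) x0.
  exists e; rewrite -ta /tp_phi; congr (_ @` _); apply/seteqP; split=> b /=.
    move=> ab f; rewrite -eP; move: f; apply/hP/dP.
    by rewrite /tp /= sat_inst.
  move=> eb; have : tp a B (inst phi b) by apply/dP/hP => f; rewrite eP.
  by rewrite /tp /= sat_inst.
exists e => t t' tt'; apply: val_inj.
by rewrite /= eP tt' -eP.
Qed.

(** The cardinal [lambda = 2 ^ |T|] satisfies [lambda ^ |T| = lambda]. *)
Lemma stable_of_count :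
  (forall B : set M, small K B -> S_phi phi B ≼ (F -> B + F)) -> stable M K phi.
Proof.
move=> count; exists (set F).
have FS : F ≼ set F.
  exists (fun x => [set x]) => x y /(congr1 (@^~ x)) /= xy.
  by have -> : x = y by rewrite -xy.
have natS : nat ≼ set F := embeds_trans (nat_embeds_form L) FS.
have Ss : small K [set: set F] := monster_strong_limit mon (monster_language mon).
split=> //; first by apply/infiniteP/card_leTE.
move=> B /card_leTr BS; apply/card_leTr.
have Bs : small K B.
  have [SK KS] := Ss; split.
    by apply: card_le_trans SK; apply/card_leTr.
  by apply: contra_not KS => /card_le_trans; apply; apply/card_leTr.
apply: embeds_trans (count B Bs) _.
apply: (@embeds_trans (F -> F -> Prop)).
  by apply: embeds_funr; apply: embeds_sum_infinite.
by apply: embeds_curry (formX_embeds L); exact: (Top, Top).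
Qed.

End Definability.

Theorem theorem3p11 (L : signature) (T : theory L)
    (jcp : joint_continuation T)
    (K : Type) (M : structure L) (mon : monster T K M)
    (m n : nat) (phi : form L ('I_m + 'I_n)) :
  [<-> stable M K phi;
       forall B : set M, small K B ->
         S_phi phi B #<= [set: form L nat -> B + form L nat];
       ~ order_property T M phi;
       ~ binary_tree_property T M phi;
       forall psi : form L ('I_m + 'I_n), negation T phi psi ->
         xord_lt (rank phi psi [set @var_eqxx L m M]) (XOrd ord_omega);
       forall B : set M, small K B ->
         forall p : set (form L ('I_m + B)), is_type p -> phi_definable phi p].
Proof.
pose no_tree := forall psi, negation T phi psi ->
  exists k, ~ has_tree phi psi [set: 'I_m -> M] setT k.
have count_stable : (forall B : set M, small K B ->
    S_phi phi B #<= [set: form L nat -> B + form L nat]) -> stable M K phi.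
  by move=> count; apply: (stable_of_count mon) => B /count /card_leTr.
have stable_no : stable M K phi -> no_tree.
  by move=> st psi npsi; apply: (stable_no_tree mon npsi st).
have rank_no : (forall psi : form L ('I_m + 'I_n), negation T phi psi ->
    xord_lt (rank phi psi [set @var_eqxx L m M]) (XOrd ord_omega)) <-> no_tree.
  split=> small_rank psi /small_rank; rewrite rank_lt_omega solutions_eqxx //.
have def_count : (forall B : set M, small K B ->
    forall p : set (form L ('I_m + B)), is_type p -> phi_definable phi p) ->
  forall B : set M, small K B ->
    S_phi phi B #<= [set: form L nat -> B + form L nat].
  by move=> def B Bs; apply/card_leTr/count_of_definable; apply: def.
have no_def : no_tree -> forall B : set M, small K B ->
    forall p : set (form L ('I_m + B)), is_type p -> phi_definable phi p.
  by move=> no B _; apply: (definable_of_no_tree mon no).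
tfae.
- by move=> /stable_no/no_def/def_count.
- move=> /count_stable/stable_no no [a [b [psi [npsi ab]]]].
  by have [k] := no psi npsi; apply; apply: trees_of_order ab k.
- apply: contra_not => -[psi [b [npsi bP]]].
  by apply: (tree_order_property mon npsi); apply: trees_of_binary_tree bP.
- move=> nbt; apply/rank_no => psi npsi; apply: contrapT => /forallNP trees.
  apply: nbt; apply: (binary_tree_of_trees mon npsi) => k.
  exact: contrapT (trees k).
- by move=> /rank_no/no_def.
- by move=> /def_count/count_stable.
Qed.
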